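(* Let $p\ge 5$ be a prime, let $e\ge1$ be an integer, and suppose $e\equiv-(p\ell+\kappa)\pmod{p^2}$ for integers $\ell,\kappa$ with $0\le\ell\le\left\lfloor\frac{p-1}{4}\right\rfloor$, where $1\le\kappa\le\left\lfloor\frac{p+2}{4}\right\rfloor$ if $p>5$, and $1\le\kappa\le2$ if $p=5$. Then for all integers $n,w$ with $1\le w\le n-1$ there is no nontrivial $e$-perfect code in $J(n,w)$.
   Context: The Johnson scheme $J(n,w)$ has as elements all $w$-subsets of $[n]=\{1,\dots,n\}$, with distance $d(X,Y)=|X\setminus Y|$. The $e$-ball centred at $X$ is the set of $w$-subsets at distance at most $e$ from $X$. An $e$-perfect code in $J(n,w)$ is a set $\mathcal C$ of $w$-subsets such that the $e$-balls centred at the elements of $\mathcal C$ partition the set of all $w$-subsets of $[n]$. It is trivial if $e=0$, or $|\mathcal C|=1$, or $n=2w$, $w=2e+1$ and $\mathcal C$ consists of a $w$-subset and its complement; otherwise it is nontrivial. *)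

(* Defs.v *)
From mathcomp Require Import all_boot all_order all_algebra.
Set Implicit Arguments. Unset Strict Implicit. Unset Printing Implicit Defensive.

(* The ground set [n] = {1, ..., n} is represented by 'I_n = {0, ..., n-1}. *)

Section Johnson.

Variables n w : nat.

Definition johnson : {set {set 'I_n}} := [set X : {set 'I_n} | #|X| == w].

Definition jdist (X Y : {set 'I_n}) : nat := #|X :\: Y|.

Definition jball (e : nat) (X : {set 'I_n}) : {set {set 'I_n}} :=
  [set Y in johnson | jdist X Y <= e].

(* The family of balls is indexed by its centres: [partition] only sees the set
   of balls, so injectivity is needed to exclude distinct centres sharing one
   and the same ball (e.g. when e is at least the diameter of the scheme). *)
Definition perfect_code (e : nat) (C : {set {set 'I_n}}) : Prop :=
  [/\ C \subset johnson,
      {in C &, injective (jball e)}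
    & partition [set jball e X | X in C] johnson].

Definition trivial_code (e : nat) (C : {set {set 'I_n}}) : Prop :=
  [\/ e = 0, #|C| = 1
    | [/\ n = 2 * w, w = 2 * e + 1
        & exists2 X : {set 'I_n}, X \in johnson & C = [set X; ~: X]]].

End Johnson.

(* Main.v *)
Require Import Defs.
From mathcomp Require Import all_boot all_order all_algebra.
From mathcomp Require Import zify ring.
Set Implicit Arguments. Unset Strict Implicit. Unset Printing Implicit Defensive.
Import Order.TTheory GRing.Theory Num.Theory.

(** Write a = w, b = n - w, and let Phi be the size of an e-ball, that is the
    sum over i <= e of C(a, i) C(b, i). Two facts about a nontrivial perfect
    code contradict each other: p^2 divides Phi, while every prime power
    dividing Phi divides certain binomial coefficients C(n - t, a - t), one of
    which has p-adic valuation at most 1.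

    Local structure. Around a codeword Z, the codewords at the minimum distance
    2e + 1 form a design: each (e+1)-subset A of Z and each (e+1)-subset B of
    its complement lie in (Z \ W, W \ Z) for a unique such W ([blocks_exist],
    [blocks_unique]). Double counting gives C(e + j, j) | C(a - e - 1 + j, j)
    for j <= e + 1 ([card_blocks]), and disjointness of blocks gives both Roos'
    inequality e b < (e+1) a, with its mirror image ([tiling_roos]), and
    (e+1)^2 <= a - e ([tiling_large]). Complementing the code exchanges a and b.

    Divisibility of Phi. Kummer's theorem applied to the above divisibilities at
    j = k and j = k + p l, for which e + j is divisible by p resp. p^2, confines
    a modulo p and modulo p^2 to short intervals that end at the residue of -j
    ([tiling_residues]); likewise b. The bounds on k and l say exactly that
    a + b then carries in the two lowest base p digits; for p = 5, k = 2 one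
    residue pair must be excluded by a second design, on pairs
    ([tiling_pairs]). Since a and b have residues modulo p^2 not exceeding that
    of e, Phi is, modulo p^2, a sum of complete blocks of p^2 consecutive terms,
    and each block vanishes by Vandermonde's identity and the two carries
    ([ball_size_dvd_sqr_prime]).

    Valuation of the binomials. The code is a t-design, so that
    Phi | C(n - t, a - t), as soon as the eigenvalues of the ball operator in
    degrees i <= t do not vanish ([tiling_design]). As a > e^2 and b is close to
    a, these eigenvalues are sums of alternating series with decreasing terms
    when 3 i <= a, hence positive ([ball_eigenvalue_gt0]). Take q with
    p^(q+1) <= n < p^(q+2) and t = a mod p^q, so that 3 t <= a. Adding b to
    a - t, a multiple of p^q, carries at most once, out of digit q, so p^2 does not
    divide C(n - t, a - t). *)

(** * Carries in binomial coefficients *)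

(** Kummer's theorem: the k-th term of the sum records whether the addition
    of x and y carries out of the k lowest base p digits. *)
Lemma logn_bin_carries (p x y : nat) (m : nat) : prime p -> x + y < p ^ m ->
  logn p 'C(x + y, x) =
  \sum_(1 <= k < m) (p ^ k <= x %% p ^ k + y %% p ^ k).
Proof.
move=> p_pr lt_m.
have fact_sum z : z < p ^ m -> logn p z`! = \sum_(1 <= k < m) z %/ p ^ k.
  move=> lt_z; rewrite logn_fact //.
  have zero k : z < p ^ k -> z %/ p ^ k = 0 by move=> h; rewrite divn_small.
  pose M := maxn z.+1 m.
  have ext r : r <= M -> (forall k, r <= k -> z < p ^ k) ->
     \sum_(1 <= k < r) z %/ p ^ k = \sum_(1 <= k < M) z %/ p ^ k.
    case: r => [|r] rM hr.
      rewrite (big_geq (leqnSn 0)) big1_seq // => k _.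
      by rewrite zero // hr.
    rewrite [RHS](big_cat_nat (n := r.+1)) //= [X in _ = _ + X]big1_seq ?addn0 //.
    move=> k /andP[_]; rewrite mem_index_iota => /andP[rk _].
    by rewrite zero // hr.
  rewrite (ext z.+1) ?leq_maxl //; last first.
    by move=> k zk; apply: leq_trans (ltn_expl k (prime_gt1 p_pr)); lia.
  rewrite -(ext m) ?leq_maxr // => k mk.
  by apply: leq_trans lt_z _; rewrite leq_exp2l // prime_gt1.
have /(congr1 (logn p)) := bin_fact (leq_addr y x).
rewrite addKn !lognM ?muln_gt0 ?fact_gt0 ?bin_gt0 ?leq_addr //.
rewrite !fact_sum //; try lia.
rewrite -big_split /= => eq1.
have : \sum_(1 <= k < m) (x + y) %/ p ^ k =
  \sum_(1 <= k < m) (p ^ k <= x %% p ^ k + y %% p ^ k) + \sum_(1 <= k < m) (x %/ p ^ k + y %/ p ^ k).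
  rewrite -big_split /=; apply: eq_bigr => k _.
  by rewrite divnD ?expn_gt0 ?prime_gt0 //; lia.
by lia.
Qed.

(** If z has r + 1 digits and adding it to x does not carry out of them, no
    carry occurs further up either. *)
Lemma logn_bin_le_low (p r x z : nat) : prime p -> z < p ^ r.+1 ->
  x %% p ^ r.+1 + z < p ^ r.+1 -> logn p 'C(x + z, x) <= r.
Proof.
move=> p_pr z_lt no_carry.
pose m := x + z + r.+2.
rewrite (@logn_bin_carries _ _ _ m) //; last first.
  by apply: leq_trans (ltn_expl m (prime_gt1 p_pr)); rewrite /m; lia.
rewrite (big_cat_nat (n := r.+1)) //=; last by rewrite /m; lia.
rewrite [X in _ + X]big1_seq ?addn0; last first.
  move=> k /andP[_]; rewrite mem_index_iota => /andP[rk _].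
  have dvd_rk : p ^ r.+1 %| p ^ k by rewrite dvdn_exp2l.
  have z_ltk : z < p ^ k by apply: leq_trans z_lt _; rewrite leq_exp2l ?prime_gt1.
  rewrite (modn_small z_ltk).
  have := divn_eq (x %% p ^ k) (p ^ r.+1).
  rewrite modn_dvdm // => xk.
  case/dvdnP: dvd_rk => c pk.
  have lt_c : x %% p ^ k %/ p ^ r.+1 < c.
    by rewrite ltn_divLR ?expn_gt0 ?prime_gt0 // -pk ltn_pmod ?expn_gt0 ?prime_gt0.
  apply/eqP; rewrite eqb0 -ltnNge xk pk -pk -addnA.
  apply: (@leq_trans ((x %% p ^ k %/ p ^ r.+1).+1 * p ^ r.+1)).
    by rewrite mulSn addnC ltn_add2r.
  by rewrite pk leq_mul2r -pk lt_c orbT.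
apply: leq_trans (leq_sum _ (fun k _ => leq_b1 _)) _.
by rewrite sum_nat_const_nat; lia.
Qed.

(** The low digits of x vanish, and the sum has only r + 1 digits above
    them; the last of these carries nothing out. *)
Lemma logn_bin_le_high (p q r x y : nat) : prime p -> p ^ q %| x ->
  x + y < p ^ (q + r.+1) -> logn p 'C(x + y, x) <= r.
Proof.
move=> p_pr dvd_x lt_xy.
rewrite (@logn_bin_carries _ _ _ (q + r.+1)) //.
rewrite (big_cat_nat (n := q.+1)) //=; last by lia.
rewrite [X in X + _]big1_seq ?add0n; last first.
  move=> k /andP[_]; rewrite mem_index_iota => /andP[_ kq].
  have /eqP-> : p ^ k %| x by apply: dvdn_trans dvd_x; rewrite dvdn_exp2l.
  by apply/eqP; rewrite eqb0 add0n -ltnNge ltn_pmod ?expn_gt0 ?prime_gt0.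
apply: leq_trans (leq_sum _ (fun k _ => leq_b1 _)) _.
by rewrite sum_nat_const_nat; lia.
Qed.

Lemma dvdn_bin_carries (p r x y : nat) : prime p ->
  (forall k, 1 <= k <= r -> p ^ k <= x %% p ^ k + y %% p ^ k) ->
  p ^ r %| 'C(x + y, x).
Proof.
move=> p_pr carry; rewrite pfactor_dvdn ?bin_gt0 ?leq_addr //.
pose m := x + y + r.+2.
rewrite (@logn_bin_carries _ _ _ m) //; last first.
  by apply: leq_trans (ltn_expl m (prime_gt1 p_pr)); rewrite /m; lia.
rewrite (big_cat_nat (n := r.+1)) //=; last by rewrite /m; lia.
rewrite (@eq_big_nat _ _ _ 1 r.+1 _ (fun=> 1)) => [|k]; last first.
  by move=> /andP[k1 kr]; rewrite carry // k1.
by rewrite sum_nat_const_nat; lia.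
Qed.


(** The binomials in e have a carry out of the lowest digit, resp. out of both
    lowest digits, so those in N have at least 1, resp. 2, carries. Adding k
    can only carry if the lowest digit does; adding k + p l would carry once at
    most if nothing left the two lowest digits. *)
Lemma digits_of_dvd_bin (p e k l N : nat) : prime p -> 0 < k -> k < p ->
  k + p * l < p ^ 2 -> p ^ 2 %| e + (k + p * l) ->
  'C(e + k, e) %| 'C(N + k, N) ->
  'C(e + (k + p * l), e) %| 'C(N + (k + p * l), N) ->
  p - k <= N %% p /\ p ^ 2 - (k + p * l) <= N %% p ^ 2.
Proof.
move=> p_pr k0 kp jp dvd_e dvd1 dvd2.
have p0 := prime_gt0 p_pr.
have carry r z : 0 < z %% p ^ r -> p ^ r %| e + z -> p ^ r <= e %% p ^ r + z %% p ^ r.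
  move=> z0 /eqP; rewrite -modnDm => h.
  rewrite leqNgt; apply/negP=> lt; move: h; rewrite modn_small // => /eqP.
  by rewrite addn_eq0 [X in _ && X]eqn0Ngt z0 andbF.
have dvd_p : p %| e + (k + p * l) by apply: dvdn_trans dvd_e; rewrite dvdn_mulr.
have dvd_ek : p %| e + k by move: dvd_p; rewrite addnA dvdn_addl ?dvdn_mulr.
have mod_j : (k + p * l) %% p = k by rewrite addnC mulnC modnMDl modn_small.
split.
  have : p ^ 1 %| 'C(e + k, e).
    apply: dvdn_bin_carries => // r r1; have -> : r = 1 by lia.
    by apply: carry; rewrite expn1 // modn_small.
  move=> /dvdn_trans/(_ dvd1); rewrite pfactor_dvdn ?bin_gt0 ?leq_addr // => v1.
  rewrite leqNgt; apply/negP => lt.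
  have : logn p 'C(N + k, N) <= 0.
    by apply: logn_bin_le_low; rewrite ?expn1 // addnC -ltn_subRL.
  by rewrite leqNgt v1.
have : p ^ 2 %| 'C(e + (k + p * l), e).
  apply: dvdn_bin_carries => // r r1; have [->|->] : r = 1 \/ r = 2 by lia.
    by apply: carry; rewrite expn1 // mod_j.
  by apply: carry => //; rewrite modn_small // ltn_addr.
move=> /dvdn_trans/(_ dvd2); rewrite pfactor_dvdn ?bin_gt0 ?leq_addr // => v2.
rewrite leqNgt; apply/negP => lt.
have : logn p 'C(N + (k + p * l), N) <= 1.
  by apply: logn_bin_le_low => //; rewrite addnC -ltn_subRL.
by rewrite leqNgt v2.
Qed.

(** * The size of a ball modulo the square of a prime *)

Section BinomialBlocks.
Local Open Scope ring_scope.
Implicit Types (P Q : {poly int}).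

Lemma coef_1Xn n m : ((1 + 'X) ^+ n : {poly int})`_m = 'C(n, m)%:R.
Proof.
elim: n m => [|n IH] m; first by rewrite expr0 coef1 bin0n.
rewrite exprS mulrDl mul1r coefD coefXM !IH.
by case: m => [|m]; rewrite ?bin0 ?addr0 // binS natrD.
Qed.

(** Multiplying Q('X^N) by a polynomial of degree less than N involves no
    overlap, which is why digits in base N separate. *)
Lemma coef_mul_comp_Xn P Q N i r : (size P <= N)%N -> (r < N)%N ->
  (P * (Q \Po 'X^N))`_(N * i + r) = P`_r * Q`_i.
Proof.
move=> sP rN; have N0 : (0 < N)%N by apply: leq_ltn_trans rN.
have r_lt : (r < (N * i + r).+1)%N by rewrite ltnS leq_addl.
rewrite coefM (bigD1 (Ordinal r_lt)) //= big1 ?addr0 => [|[j j_lt] /= j_neq].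
  by rewrite addnK coef_comp_poly_Xn // dvdn_mulr // mulKn.
rewrite coef_comp_poly_Xn //; case: ifP => [dvd_j|]; last by rewrite mulr0.
have [Nj|jN] := leqP N j; first by rewrite nth_default ?mul0r //; apply: leq_trans Nj.
case/eqP: j_neq; apply: val_inj => /=.
have : (N * i + r = j %[mod N])%N.
  by apply/eqP; rewrite eqn_mod_dvd.
by rewrite mulnC modnMDl !modn_small.
Qed.

(** First order Taylor expansion, with t in the role of p. *)
Lemma expr_add_mul (x y t : {poly int}) m :
  exists z, (x + t * y) ^+ m = x ^+ m + t * (m%:R * x ^+ m.-1 * y) + t ^+ 2 * z.
Proof.
elim: m => [|m [z IH]]; first by exists 0; rewrite !expr0; ring.
exists (m%:R * x ^+ m.-1 * y ^+ 2 + (x + t * y) * z).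
rewrite exprS IH -natr1 /=; case: m {IH} => [|m] /=; rewrite ?exprS; ring.
Qed.

Lemma expr_1X_prime p : prime p ->
  exists H : {poly int}, (1 + 'X) ^+ p = 1 + 'X^p + p%:R * H.
Proof.
move=> p_pr.
exists (\sum_(0 <= i < p.-1) 'X^(i.+1) *+ ('C(p, i.+1) %/ p)).
have -> : (1 + 'X) ^+ p = \sum_(0 <= i < p.+1) 'X^i *+ 'C(p, i) :> {poly int}.
  by rewrite exprDn big_mkord; apply: eq_bigr => i _; rewrite expr1n mul1r.
case: p p_pr => // p p_pr.
rewrite big_nat_recr //= big_nat_recl //= bin0 binn expr0.
rewrite !mulr1n addrAC; congr (_ + _).
rewrite mulr_sumr; apply: eq_big_nat => i /andP[_ ip].
rewrite mulr_natl -mulrnA divnK //.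
by apply: prime_dvd_bin => //; rewrite ltnS ip.
Qed.

Lemma mul_expansions (R : comNzRingType) (t u um h k v r s : R) :
  (u + t * h + t ^+ 2 * (v + s)) * (um + t * k + t ^+ 2 * r) =
  u * um + t * (um * h + u * k)
  + t ^+ 2 * (r * (u + t * h + t ^+ 2 * (v + s)) + k * h
              + (um + t * k) * (v + s)).
Proof. ring. Qed.

(** Passing from p to p^2, the error of the Frobenius congruence is, modulo p^2,
    p times a polynomial in 'X^p: it does not see the lowest digit. *)
Lemma expr_1X_sqr_prime p m : prime p -> exists K R : {poly int},
  (1 + 'X) ^+ (p ^ 2 * m)
    = (1 + 'X^(p ^ 2)) ^+ m + p%:R * (K \Po 'X^p) + p%:R ^+ 2 * R.
Proof.
move=> p_pr; have [H EH] := expr_1X_prime p_pr.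
have [z1 E1] := expr_add_mul (1 + 'X^p) H p%:R p.
elim: m => [|m [K [R IH]]].
  by exists 0, 0; rewrite muln0 !expr0 comp_poly0; ring.
have E2 : (1 + 'X^p) ^+ p = 1 + 'X^(p ^ 2) + p%:R * (H \Po 'X^p) :> {poly int}.
  have := congr1 (fun P => P \Po 'X^p) EH.
  rewrite /= rmorphXn /= !rmorphD /= !rmorph1 rmorphM rmorph_nat /=.
  rewrite comp_polyX rmorphXn /= comp_polyX -exprM => ->.
  by rewrite expnS expn1.
exists ((1 + 'X^p) ^+ m * H + (1 + 'X^p) * K).
exists (R * (1 + 'X) ^+ (p ^ 2) + (K \Po 'X^p) * (H \Po 'X^p)
  + ((1 + 'X^(p ^ 2)) ^+ m + p%:R * (K \Po 'X^p)) *
     ((1 + 'X^p) ^+ p.-1 * H + z1)).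
rewrite mulnS exprD IH.
have E3 : (1 + 'X) ^+ (p ^ 2) = 1 + 'X^(p ^ 2) + p%:R * (H \Po 'X^p) +
   p%:R ^+ 2 * ((1 + 'X^p) ^+ p.-1 * H + z1) :> {poly int}.
  by rewrite {1}expnS expn1 exprM EH E1 E2; ring.
rewrite E3 !(rmorphD, rmorphM, rmorphXn, rmorph1) /=.
rewrite comp_polyX -!exprM mulnn [(1 + _) ^+ m.+1]exprS.
exact: mul_expansions.
Qed.

Lemma size_1Xn n N : (n < N)%N -> (size ((1 + 'X) ^+ n : {poly int}) <= N)%N.
Proof.
move=> nN; apply/leq_sizeP => j Nj; rewrite coef_1Xn bin_small //.
exact: leq_trans Nj.
Qed.

Lemma coef_natmull c P m : (c%:R * P)`_m = c%:R * P`_m.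
Proof. by rewrite !mulr_natl coefMn. Qed.

Lemma expr_1X_digits p a : prime p -> exists R : {poly int},
  (1 + 'X) ^+ a = (1 + 'X) ^+ (a %% p) * ((1 + 'X) ^+ (a %/ p) \Po 'X^p)
                  + p%:R * R.
Proof.
move=> p_pr; have [H EH] := expr_1X_prime p_pr.
have [y Ey] := expr_add_mul (1 + 'X^p) H p%:R (a %/ p).
exists ((1 + 'X) ^+ (a %% p) *
  ((a %/ p)%:R * (1 + 'X^p) ^+ (a %/ p).-1 * H + p%:R * y)).
rewrite [in LHS](divn_eq a p) exprD mulnC exprM EH Ey.
by rewrite !(rmorphD, rmorphXn, rmorph1) /= comp_polyX; ring.
Qed.

(** Lucas' theorem. *)
Lemma bin_prime_block p a i r : prime p -> (r < p)%N -> exists z : int,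
  'C(a, p * i + r)%:R = 'C(a %% p, r)%:R * 'C(a %/ p, i)%:R + p%:R * z.
Proof.
move=> p_pr rp; have [R ER] := expr_1X_digits a p_pr.
exists R`_(p * i + r); rewrite -coef_1Xn ER coefD coef_natmull.
by rewrite coef_mul_comp_Xn ?size_1Xn ?ltn_pmod ?prime_gt0 // !coef_1Xn.
Qed.

(** Lucas' congruence for blocks of length p^2 fails modulo p^2, but the error
    term has a factor p and factors through the binomial coefficient of the
    lowest digits, so that summing over that digit will kill it. *)
Lemma bin_sqr_prime_block p a : prime p -> exists k : nat -> nat -> int,
  forall i r, (r < p ^ 2)%N -> exists z : int,
    'C(a, p ^ 2 * i + r)%:R =
      'C(a %% p ^ 2, r)%:R * 'C(a %/ p ^ 2, i)%:R
      + p%:R * ('C(a %% p, r %% p)%:R * k i (r %/ p)%N) + p%:R ^+ 2 * z.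
Proof.
move=> p_pr; have p0 := prime_gt0 p_pr; set q := (p ^ 2)%N.
have q0 : (0 < q)%N by rewrite expn_gt0 p0.
have [K [R EK]] := expr_1X_sqr_prime (a %/ q) p_pr.
have [z] := expr_1X_digits (a %% q) p_pr.
rewrite modn_dvdm; last by rewrite /q expnS dvdn_mulr.
move: (a %% q %/ p)%N => A1 E2.
pose L := (1 + 'X) ^+ A1 * K : {poly int}.
pose W := (1 + 'X) ^+ (a %% q) * R + z * (K \Po 'X^p) : {poly int}.
have E3 : (1 + 'X) ^+ a = (1 + 'X) ^+ (a %% q) * ((1 + 'X) ^+ (a %/ q) \Po 'X^q)
   + p%:R * ((1 + 'X) ^+ (a %% p) * (L \Po 'X^p)) + (p ^ 2)%:R * W.
  rewrite natrX [in LHS](divn_eq a q) exprD mulnC EK /L rmorphM /=.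
  have -> : (1 + 'X) ^+ (a %/ q) \Po 'X^q = (1 + 'X^q) ^+ (a %/ q) :> {poly int}.
    by rewrite !(rmorphD, rmorphXn, rmorph1) /= comp_polyX.
  rewrite /W; move: ((1 + 'X) ^+ (a %% q)) E2 => _ ->.
  move: (_ ^+ (a %% p)) (_ \Po _) (K \Po _) (_ ^+ (a %/ q)) => *; ring.
exists (fun i r1 => L`_(p * i + r1)) => i r rq; exists W`_(q * i + r).
rewrite -coef_1Xn E3 coefD [X in X + _]coefD !coef_natmull natrX; congr (_ + _ * _ + _).
  by rewrite coef_mul_comp_Xn ?size_1Xn ?ltn_pmod // !coef_1Xn.
have -> : (q * i + r = p * (p * i + r %/ p) + r %% p)%N.
  by rewrite mulnDr -addnA mulnA mulnn [(p * (r %/ p))%N]mulnC -divn_eq.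
by rewrite coef_mul_comp_Xn ?size_1Xn ?ltn_pmod // coef_1Xn.
Qed.

End BinomialBlocks.

Local Open Scope nat_scope.

Lemma sum_bin_mul a b N : a < N -> \sum_(r < N) 'C(a, r) * 'C(b, r) = 'C(a + b, a).
Proof.
move=> aN; rewrite addnC -binomial.Vandermonde.
rewrite [RHS](eq_bigr (fun r : 'I_a.+1 => 'C(a, r) * 'C(b, r))); last first.
  by move=> [r r_lt] _ /=; rewrite mulnC bin_sub.
rewrite -[LHS](big_mkord xpredT (fun r => 'C(a, r) * 'C(b, r))).
rewrite (big_cat_nat (n := a.+1)) //= big_mkord [X in _ + X]big1_seq ?addn0 //.
move=> r /andP[_]; rewrite mem_index_iota => /andP[ar _].
by rewrite bin_small.
Qed.

Lemma sum_blocks (R : nmodType) (F : nat -> R) q m :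
  (\sum_(i < q * m) F i = \sum_(j < m) \sum_(r < q) F (q * j + r)%N)%R.
Proof.
elim: m => [|m IH]; first by rewrite muln0 !big_ord0.
by rewrite mulnS addnC big_split_ord big_ord_recr -IH.
Qed.

(** Cut the sum into blocks of p^2 consecutive terms. In a complete block the
    main term sums to C(a mod p^2 + b mod p^2, a mod p^2), divisible by p^2 as
    both digits carry; the error terms carry a factor p and, summed over the
    lowest digit, the factor C(a mod p + b mod p, a mod p), divisible by p.
    In the incomplete block the missing terms have digits exceeding those of
    both a and b, so each of their two factors is divisible by p. *)
Lemma ball_size_dvd_sqr_prime p e a b : prime p ->
  p <= a %% p + b %% p -> p ^ 2 <= a %% p ^ 2 + b %% p ^ 2 ->
  a %% p ^ 2 <= e %% p ^ 2 -> b %% p ^ 2 <= e %% p ^ 2 ->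
  p ^ 2 %| \sum_(i < e.+1) 'C(a, i) * 'C(b, i).
Proof.
move=> p_pr carry1 carry2 ae be; have p0 := prime_gt0 p_pr.
pose F i := 'C(a, i) * 'C(b, i).
set q := p ^ 2; have q0 : 0 < q by rewrite expn_gt0 p0.
have dvd_pq : p %| q by rewrite /q expnS dvdn_mulr.
have [ka Ea] := bin_sqr_prime_block a p_pr.
have [kb Eb] := bin_sqr_prime_block b p_pr.
have dvd_int (d m : nat) (z : int) : (m%:R = d%:R * z)%R -> d %| m.
  rewrite !natz => Em.
  by have : (d%:Z %| m%:Z)%Z by apply/dvdzP; exists z; rewrite Em mulrC.
have Eq : (q%:R = p%:R ^+ 2 :> int)%R by rewrite natrX.
have tail i r : e %% q < r -> r < q -> q %| F (q * i + r).
  move=> er rq; rewrite /F /q expnS expn1.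
  have [za Ea'] := Ea i r rq; have [zb Eb'] := Eb i r rq.
  rewrite (bin_small (leq_ltn_trans ae er)) mul0r add0r in Ea'.
  rewrite (bin_small (leq_ltn_trans be er)) mul0r add0r in Eb'.
  apply: dvdn_mul; [apply: dvd_int (etrans Ea' _)|apply: dvd_int (etrans Eb' _)];
    rewrite expr2 -mulrA -mulrDr; reflexivity.
have block i : q %| \sum_(r < q) F (q * i + r).
  pose m r1 : int := ('C(a %% q %/ p, r1)%:R * 'C(a %/ q, i)%:R * kb i r1
    + 'C(b %% q %/ p, r1)%:R * 'C(b %/ q, i)%:R * ka i r1)%R.
  have term r : r < q -> exists z : int, ((F (q * i + r))%:R =
     ('C(a %% q, r) * 'C(b %% q, r))%:R * ('C(a %/ q, i) * 'C(b %/ q, i))%:R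
     + p%:R * (('C(a %% p, r %% p) * 'C(b %% p, r %% p))%:R * m (r %/ p)%N)
     + q%:R * z)%R.
    move=> rq; have [za Ea'] := Ea i r rq; have [zb Eb'] := Eb i r rq.
    have Er : r = p * (r %/ p) + r %% p by rewrite mulnC -divn_eq.
    have := bin_prime_block (a %% q) (r %/ p) p_pr (ltn_pmod r p0).
    have := bin_prime_block (b %% q) (r %/ p) p_pr (ltn_pmod r p0).
    rewrite -Er !modn_dvdm // => -[yb Lb] [ya La].
    rewrite /F Eq !natrM Ea' Eb' /m.
    move: 'C(a %% p, r %% p)%:R%R 'C(b %% p, r %% p)%:R%R La Lb => a0 b0.
    move: 'C(a %% q %/ p, r %/ p)%:R%R 'C(b %% q %/ p, r %/ p)%:R%R => a1 b1.
    move: 'C(a %% q, r)%:R%R 'C(b %% q, r)%:R%R => _ _ -> ->.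
    move: 'C(a %/ q, i)%:R%R 'C(b %/ q, i)%:R%R => a2 b2.
    move: (ka i _) (kb i _) p%:R%R => u v t.
    exists (ya * a2 * b0 * v + yb * b2 * a0 * u + a0 * b0 * u * v
      + za * ((b0 * b1 + t * yb) * b2 + t * (b0 * v) + t ^+ 2 * zb)
      + ((a0 * a1 + t * ya) * a2 + t * (a0 * u)) * zb)%R.
    ring.
  have /fin_all_exists [z Ez] : forall r : 'I_q, exists z : int, _ :=
    fun r => term r (ltn_ord r).
  have dvd1 : p ^ 1 %| 'C(a %% p + b %% p, a %% p).
    apply: dvdn_bin_carries => // k k1; have -> : k = 1 by lia.
    by rewrite expn1 !modn_mod.
  have dvd2 : q %| 'C(a %% q + b %% q, a %% q).
    apply: dvdn_bin_carries => // k k1; have [->|->] : k = 1 \/ k = 2 by lia.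
      by rewrite expn1 !modn_dvdm //.
    by rewrite !modn_mod.
  case/dvdnP: dvd1 => c1 E1; case/dvdnP: dvd2 => c2 E2.
  apply: (dvd_int _ _ (c2%:R * ('C(a %/ q, i) * 'C(b %/ q, i))%:R
     + \sum_(j < p) m j * c1%:R + \sum_r z r)%R).
  rewrite natr_sum (eq_bigr _ (fun r _ => Ez r)) !big_split /=.
  rewrite -mulr_suml -natr_sum sum_bin_mul ?ltn_pmod // E2 -!mulr_sumr.
  have -> : (\sum_(r < q) ('C(a %% p, r %% p) * 'C(b %% p, r %% p))%:R
       * m (r %/ p)%N = \sum_(j < p) m j * c1%:R * p%:R)%R.
    rewrite /q expnS expn1 (sum_blocks (fun r =>
       ('C(a %% p, r %% p) * 'C(b %% p, r %% p))%:R * m (r %/ p)%N)%R).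
    apply: eq_bigr => j _ /=.
    under eq_bigr => r _ do
      rewrite [(p * j)%N]mulnC modnMDl (modn_small (ltn_ord r))
        divnMDl // (divn_small (ltn_ord r)) addn0.
    by rewrite -mulr_suml -natr_sum sum_bin_mul ?ltn_pmod // E1 expn1 natrM; ring.
  by rewrite -mulr_suml Eq natrM Eq; ring.
pose M := (e %/ q).+1.
have e_lt : e.+1 <= q * M.
  by rewrite mulnC mulSn {1}(divn_eq e q) addnC -addSn leq_add2r ltn_pmod.
have : q %| \sum_(i < q * M) F i.
  by rewrite sum_blocks; apply: dvdn_sum => j _; apply: block.
rewrite -(big_mkord xpredT F) (big_cat_nat (n := e.+1)) //= big_mkord.
rewrite dvdn_addl // big_nat_cond; apply: dvdn_sum => i /andP[/andP[ei iM] _].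
rewrite (divn_eq i q) mulnC; apply: tail; last by rewrite ltn_pmod.
have Ei : i %/ q = e %/ q.
  apply/eqP; rewrite eqn_leq (leq_div2r _ (ltnW ei)) andbT -ltnS.
  by rewrite ltn_divLR // mulnC.
by move: ei; rewrite {1}(divn_eq e q) {1}(divn_eq i q) Ei ltn_add2l.
Qed.

(** * Positivity of the eigenvalues of balls *)

Section EberleinPositivity.
Local Open Scope ring_scope.

(** A finite difference of order t + 1 is a difference of order t of a
    difference, by Pascal's rule. *)
Lemma sum_alt_binS (F : nat -> int) t :
  \sum_(s < t.+2) (-1) ^+ s * 'C(t.+1, s)%:R * F s
  = \sum_(s < t.+1) (-1) ^+ s * 'C(t, s)%:R * (F s - F s.+1).
Proof.
under [RHS]eq_bigr do rewrite mulrBr.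
rewrite sumrB big_ord_recl [X in _ = X - _]big_ord_recl /= !bin0 -addrA.
congr (_ + _).
have -> : \sum_(i < t) (-1) ^+ bump 0 i * 'C(t, bump 0 i)%:R * F (bump 0 i) =
  \sum_(i < t.+1) (-1) ^+ i.+1 * 'C(t, i.+1)%:R * F i.+1.
  by rewrite [RHS]big_ord_recr /= bin_small // mulr0 mul0r addr0.
rewrite -sumrB; apply: eq_bigr => i _ /=.
by rewrite /bump add1n binS natrD exprS; ring.
Qed.

(** The left-hand side is how the eigenvalue of a sphere of radius d arises from
    inclusion-exclusion; the right-hand side is the Eberlein polynomial, whose
    terms decrease in absolute value. Both satisfy L(t+1, d) = L(t, d) - L(t, d-1)
    with b - t fixed. *)
Lemma eberlein_sum t A b d : (t <= b)%N ->
  \sum_(s < t.+1) (-1) ^+ s * 'C(t, s)%:R *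
     ((s <= d)%N%:R * 'C(A + s, d)%:R * 'C(b - s, d - s)%:R)
  = \sum_(j < t.+1) (-1) ^+ j * 'C(t, j)%:R *
     ((j <= d)%N%:R * 'C(A, d - j)%:R * 'C(b - t, d - j)%:R) :> int.
Proof.
elim: t b d => [|t IH] b d tb; first by rewrite !big_ord1 addn0 !subn0.
case: b tb => // b tb.
pose F d s : int := (s <= d)%N%:R * 'C(A + s, d)%:R * 'C(b.+1 - s, d - s)%:R.
pose G d j : int := (j <= d)%N%:R * 'C(A, d - j)%:R * 'C(b - t, d - j)%:R.
rewrite subSS (sum_alt_binS (F d)) (sum_alt_binS (G d)).
case: d => [|d].
  have F0 s : F 0%N s.+1 = 0 by rewrite /F ltn0 !mul0r.
  have G0 s : G 0%N s.+1 = 0 by rewrite /G ltn0 !mul0r.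
  under eq_bigr => s _ do rewrite F0 subr0.
  under [RHS]eq_bigr => s _ do rewrite G0 subr0.
  rewrite /G -(IH _ 0%N) //; apply: eq_bigr => s _; congr (_ * _).
  by rewrite /F !sub0n !bin0.
rewrite (eq_bigr (fun s : 'I_t.+1 =>
   (-1) ^+ s * 'C(t, s)%:R * ((s <= d.+1)%N%:R * 'C(A + s, d.+1)%:R * 'C(b - s, d.+1 - s)%:R)
 - (-1) ^+ s * 'C(t, s)%:R * ((s <= d)%N%:R * 'C(A + s, d)%:R * 'C(b - s, d - s)%:R)));
  last first.
  move=> [s /= st] _; rewrite -mulrBr; congr (_ * _).
  rewrite /F !subSS addnS ltnS binS natrD.
  have [sd|ds] := leqP s d.
    have sb : (s <= b)%N by lia.
    rewrite (leqW sd) !subSn //.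
    by rewrite binS natrD; ring.
  case: (leqP s d.+1) => sd1; last by rewrite !mul0r !subr0.
  have -> : s = d.+1 by lia.
  by rewrite subnn !bin0 !mul0r.
rewrite sumrB !IH // -sumrB; apply: eq_bigr => j _.
by rewrite -mulrBr /G subSS ltnS.
Qed.

Lemma alternating_sum_bounds (u : nat -> int) m :
  (forall j, 0 <= u j.+1 <= u j) -> 0 <= u 0%N ->
  0 <= \sum_(j < m) (-1) ^+ j * u j <= u 0%N.
Proof.
elim: m u => [|m IH] u u_dec u0; first by rewrite big_ord0 lexx.
rewrite big_ord_recl expr0 mul1r.
have -> : \sum_(i < m) (-1) ^+ lift ord0 i * u (lift ord0 i)
    = - \sum_(i < m) (-1) ^+ i * u i.+1.
  by rewrite -sumrN; apply: eq_bigr => i _; rewrite /= /bump add1n exprS; ring.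
have /andP[u1 u10] := u_dec 0%N.
have /= /andP[s0 s1] := IH (fun j => u j.+1) (fun j => u_dec j.+1) u1.
by rewrite subr_ge0 gerBl s0 andbT (le_trans s1).
Qed.

Lemma eberlein_terms_decrease t A B d j : (t * d ^ 2 <= (A - d) * (B - d))%N ->
  (j < d)%N ->
  ('C(t, j.+1) * ('C(A, d - j.+1) * 'C(B, d - j.+1))
     <= 'C(t, j) * ('C(A, d - j) * 'C(B, d - j)))%N.
Proof.
move=> t_small jd; have [r Er] : exists r, (d - j = r.+1)%N by exists (d - j.+1)%N; lia.
have -> : (d - j.+1 = r)%N by lia.
rewrite Er -(leq_pmul2l (_ : 0 < j.+1 * r.+1 ^ 2)%N) // -mulnn.
have Et := mul_bin_left t j; have EA := mul_bin_left A r.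
have EB := mul_bin_left B r.
have -> : (j.+1 * (r.+1 * r.+1) * ('C(t, j.+1) * ('C(A, r) * 'C(B, r))) =
   (t - j) * (r.+1 * r.+1) * ('C(t, j) * ('C(A, r) * 'C(B, r))))%N.
  by rewrite mulnACA Et; ring.
have -> : (j.+1 * (r.+1 * r.+1) * ('C(t, j) * ('C(A, r.+1) * 'C(B, r.+1))) =
   j.+1 * ((A - r) * (B - r)) * ('C(t, j) * ('C(A, r) * 'C(B, r))))%N.
  transitivity (j.+1 * 'C(t, j) * ((r.+1 * 'C(A, r.+1)) * (r.+1 * 'C(B, r.+1))))%N.
    by ring.
  by rewrite EA EB; ring.
apply: leq_mul => //; apply: (@leq_trans (t * d ^ 2)%N).
  by rewrite -mulnn; do 2?apply: leq_mul; lia.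
apply: leq_trans t_small _; rewrite -[X in (X <= _)%N]mul1n.
by do 2?apply: leq_mul; lia.
Qed.

Lemma eberlein_ge0 t A B d : (t * d ^ 2 <= (A - d) * (B - d))%N ->
  0 <= \sum_(j < t.+1) (-1) ^+ j * 'C(t, j)%:R *
     ((j <= d)%N%:R * 'C(A, d - j)%:R * 'C(B, d - j)%:R) :> int.
Proof.
move=> t_small.
pose u j : int := ('C(t, j) * ((j <= d)%N * ('C(A, d - j) * 'C(B, d - j))))%:R.
rewrite (eq_bigr (fun j : 'I_t.+1 => (-1) ^+ j * u j)); last first.
  by move=> j _; rewrite /u !natrM; ring.
suff u_dec j : 0 <= u j.+1 <= u j.
  by case/andP: (alternating_sum_bounds t.+1 u_dec (ler0n _ _)).
rewrite ler0n ler_nat.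
have [jd|dj] := ltnP j d; last by rewrite mul0n muln0.
by rewrite (ltnW jd) !mul1n eberlein_terms_decrease.
Qed.

(** The eigenvalue in degree t of the ball operator is the sum of those of the
    spheres of radius d <= e; radius 0 contributes 1 and the others are
    nonnegative. *)
Lemma ball_eigenvalue_gt0 e t a b : (t <= a)%N -> (t <= b)%N ->
  (t * e ^ 2 <= (a - t - e) * (b - t - e))%N ->
  0 < \sum_(s < t.+1) (-1) ^+ s * 'C(t, s)%:R * \sum_(d < e.+1)
        ((s <= d)%N * 'C(a - t + s, d) * 'C(b - s, d - s))%:R :> int.
Proof.
move=> ta tb t_small.
under eq_bigr => s _ do rewrite mulr_sumr.
rewrite exchange_big big_ord_recl /= ltr_pwDl //.
  rewrite big_ord_recl /= big1 ?addr0 => [|i _]; last by rewrite mul0n mul0n mulr0.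
  by rewrite !bin0.
apply: sumr_ge0 => d _.
rewrite (eq_bigr (fun s : 'I_t.+1 => (-1) ^+ s * 'C(t, s)%:R *
   ((s <= bump 0 d)%N%:R * 'C(a - t + s, bump 0 d)%:R
      * 'C(b - s, bump 0 d - s)%:R))); last by move=> s _; rewrite !natrM.
rewrite eberlein_sum // eberlein_ge0 //.
have de : (bump 0 d <= e)%N by rewrite /bump add1n.
apply: (@leq_trans (t * e ^ 2)%N); first by rewrite leq_mul // leq_exp2r.
by apply: leq_trans t_small _; rewrite leq_mul // leq_sub2l.
Qed.

End EberleinPositivity.

(** * Codewords at minimum distance *)

Section Counting.
Variables (I J : finType) (P : pred I) (Q : pred J) (r : I -> J -> bool).

Lemma double_count :
  \sum_(i | P i) #|[set j | Q j & r i j]| = \sum_(j | Q j) #|[set i | P i & r i j]|.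
Proof.
under eq_bigr do rewrite -sum1_card.
under [RHS]eq_bigr do rewrite -sum1_card.
rewrite (exchange_big_dep Q) /= => [|i j _]; last by rewrite inE => /andP[].
apply: eq_bigr => j Qj; apply: eq_bigl => i.
by rewrite !inE Qj.
Qed.

End Counting.

Section SetLemmas.
Variable V : finType.
Implicit Types A B L S U X Y Z : {set V}.

Lemma exists_subset_card S k : k <= #|S| -> exists2 A : {set V}, A \subset S & #|A| = k.
Proof.
rewrite -bin_gt0 -cards_draws card_gt0 => /set0Pn[A].
by rewrite inE => /andP[sAS /eqP cA]; exists A.
Qed.

Lemma card_between L U k : L \subset U -> #|L| <= k ->
  #|[set A : {set V} | (L \subset A) && (A \subset U) & #|A| == k]|
    = 'C(#|U| - #|L|, k - #|L|).
Proof.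
move=> sLU Lk; rewrite -(cardsDS sLU) -cards_draws.
have disj (A : {set V}) : A \subset U :\: L -> [disjoint A & L].
  by rewrite subsetD => /andP[].
rewrite -[RHS](card_in_imset (f := fun A => A :|: L)) => [|A B]; last first.
  rewrite !inE => /andP[sA _] /andP[sB _] eqAB.
  have dA := disj _ sA; have dB := disj _ sB.
  have /(congr1 (fun S => S :\: L)) := eqAB.
  by rewrite !setDUl setDv !setU0 (setDidPl dA) (setDidPl dB).
apply: eq_card => A; apply/idP/imsetP.
  rewrite inE => /andP[/andP[sLA sAU] /eqP cA].
  exists (A :\: L) => /=; last first.
    apply/setP=> x; rewrite !inE.
    by case: (boolP (x \in L)) => [/(subsetP sLA)->|]; rewrite ?orbF.
  by rewrite inE setSD //= cardsDS // cA.
case=> D; rewrite inE => /andP[sD /eqP cD] ->; rewrite inE subsetUr subUset sLU.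
rewrite (subset_trans sD) ?subsetDl //= cardsU (disjoint_setI0 (disj _ sD)) cards0.
by rewrite cD subn0 subnK.
Qed.

Lemma card_setD_split A Z X : A \subset Z ->
  #|Z :\: X| = #|(Z :\: A) :\: X| + #|A :\: X|.
Proof.
move=> sAZ; rewrite -(cardsID A (Z :\: X)) addnC; congr (_ + _).
  by rewrite setDDl setUC -setDDl.
by rewrite setIC setIDA (setIidPl sAZ).
Qed.

Lemma card_setD_sym X Y : #|X| = #|Y| -> #|X :\: Y| = #|Y :\: X|.
Proof. by have := cardsID Y X; have := cardsID X Y; rewrite setIC; lia. Qed.

Lemma card_exchange A B Z : A \subset Z -> [disjoint B & Z] -> #|A| = #|B| ->
  #|(Z :\: A) :|: B| = #|Z|.
Proof.
move=> sAZ dBZ cAB; rewrite cardsU disjoint_setI0; last first.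
  by apply: disjointWl (subsetDl _ _) _; rewrite disjoint_sym.
by rewrite cards0 cardsDS // subn0 -cAB subnK // subset_leq_card.
Qed.

End SetLemmas.

Section Tilings.
Variable V : finType.
Implicit Types (w e : nat) (C : {set {set V}}) (A B W X Y Z T S : {set V}).

(** The property of a perfect code that is used throughout; unlike the balls
    themselves it does not mention the ambient scheme, which makes it easy to
    transport to complements. *)
Definition ball_tiling w e C : Prop :=
  (forall W, W \in C -> #|W| = w) /\
  (forall X, #|X| = w -> exists W, [/\ W \in C, #|X :\: W| <= e &
     forall W', W' \in C -> #|X :\: W'| <= e -> W' = W]).

Lemma ball_tiling_setC w e C : w <= #|V| -> ball_tiling w e C ->
  ball_tiling (#|V| - w) e [set ~: W | W in C].
Proof.
move=> wV [Cw cover]; split=> [_ /imsetP[W /Cw cW ->]|X cX].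
  by rewrite cardsCs setCK cW.
have cXC : #|~: X| = w by rewrite cardsCs setCK cX subKn.
have dist W : W \in C -> #|X :\: ~: W| = #|~: X :\: W|.
  move=> /Cw cW; rewrite setDE setCK setIC -[X in W :&: X]setCK -setDE.
  by rewrite card_setD_sym // cW cXC.
have [W [CW dW uniqW]] := cover _ cXC; exists (~: W).
split; [exact: imset_f | by rewrite dist |].
by move=> _ /imsetP[W' CW' ->]; rewrite dist // => /uniqW->.
Qed.

Section Local.
Variables (w e : nat) (C : {set {set V}}).
Hypothesis tiling : ball_tiling w e C.

Let Cw W : W \in C -> #|W| = w. Proof. by case: tiling => + _; apply. Qed.

Lemma tiling_eq X W W' : #|X| = w -> W \in C -> W' \in C ->
  #|X :\: W| <= e -> #|X :\: W'| <= e -> W = W'.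
Proof.
case: tiling => _ /(_ X) + cX => /(_ cX)[W0 [_ _ W0uniq]] CW CW' dW dW'.
by rewrite (W0uniq W) // (W0uniq W').
Qed.

(** Two centres at distance at most 2e share the ball point half-way between
    them, obtained by exchanging half of W :\: W' for half of W' :\: W. *)
Lemma tiling_min_distance W W' : W \in C -> W' \in C ->
  #|W :\: W'| <= 2 * e -> W = W'.
Proof.
move=> CW CW' d_le; have cW := Cw CW; have cW' := Cw CW'.
have d_sym : #|W :\: W'| = #|W' :\: W| by rewrite card_setD_sym // cW.
have [|A sA cA] := @exists_subset_card _ (W :\: W') (#|W :\: W'| %/ 2).
  exact: leq_div.
have [|B sB cB] := @exists_subset_card _ (W' :\: W) (#|W :\: W'| %/ 2).
  by rewrite -d_sym leq_div.
have sAW : A \subset W by apply: subset_trans sA (subsetDl _ _).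
have dBW : [disjoint B & W] by move: sB; rewrite subsetD => /andP[].
have sBW' : B \subset W' by apply: subset_trans sB (subsetDl _ _).
apply: (@tiling_eq ((W :\: A) :|: B)) => //.
- by rewrite card_exchange // cA cB.
- rewrite setDUl (_ : (W :\: A) :\: W = set0) ?set0U; last first.
    by apply/eqP; rewrite setD_eq0 subsetDl.
  have : B :\: W \subset B by apply: subsetDl.
  by move/subset_leq_card; rewrite cB; lia.
- rewrite setDUl (_ : B :\: W' = set0) ?setU0; last by apply/eqP; rewrite setD_eq0.
  by rewrite setDDl setUC -setDDl cardsDS // cA; lia.
Qed.

(** Codewords at the minimum distance 2e + 1 from Z, seen as blocks of a design
    whose points are pairs of subsets of Z and of its complement. *)
Definition blocks Z A B : {set {set V}} :=
  [set W in C | [&& #|Z :\: W| == 2 * e + 1, A \subset Z :\: W & B \subset W :\: Z]].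

(** Two blocks meet in few points because the distance between the two
    codewords is 4e + 2 minus the number of common points. *)
Lemma blocks_meet Z A B A' B' W W' : Z \in C -> W \in blocks Z A B ->
  W' \in blocks Z A' B' -> W != W' ->
  #|(Z :\: W) :&: (Z :\: W')| + #|(W :\: Z) :&: (W' :\: Z)| <= 2 * e + 1.
Proof.
move=> CZ; rewrite !inE => /and4P[CW /eqP cZW _ _] /and4P[CW' /eqP cZW' _ _] neqW.
have cWZ : #|W :\: Z| = 2 * e + 1 by rewrite card_setD_sym // !Cw.
have : 2 * e < #|W :\: W'|.
  by rewrite ltnNge; apply: contra neqW => /tiling_min_distance->.
rewrite -(cardsID Z (W :\: W')).
have -> : (W :\: W') :&: Z = (Z :\: W') :\: (Z :\: W).
  by apply/setP=> x; rewrite !inE; do 3?case: (x \in _).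
have -> : (W :\: W') :\: Z = (W :\: Z) :\: (W' :\: Z).
  by apply/setP=> x; rewrite !inE; do 3?case: (x \in _).
have := cardsID (Z :\: W) (Z :\: W'); rewrite setIC.
have := cardsID (W' :\: Z) (W :\: Z).
lia.
Qed.

(** The exchange of A for B moves Z to a set at distance e + 1, covered by
    another centre W; as W is at distance at least 2e + 1 from Z, every
    exchanged element must bring the set closer to W. *)
Lemma blocks_exist Z A B : Z \in C -> A \subset Z -> [disjoint B & Z] ->
  #|A| = e.+1 -> #|B| = e.+1 -> exists W, W \in blocks Z A B.
Proof.
move=> CZ sAZ dBZ cA cB.
have cY : #|(Z :\: A) :|: B| = w.
  rewrite (card_exchange sAZ dBZ); [exact: Cw | by rewrite cA cB].
have [W [CW dW _]] := tiling.2 _ cY; exists W.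
have BZ : B :\: Z = B by apply/setDidPl.
have neqZW : Z != W.
  apply: contraTneq dW => <-; rewrite -ltnNge -cB.
  by rewrite subset_leq_card // setDUl BZ subsetUr.
have : 2 * e < #|Z :\: W|.
  by rewrite ltnNge; apply: contra neqZW => /tiling_min_distance->.
rewrite (card_setD_split W sAZ) => d_gt.
have dY : #|(Z :\: A) :\: W| + #|B :\: W| <= e.
  apply: leq_trans dW; rewrite setDUl cardsU disjoint_setI0 ?cards0 ?subn0 //.
  apply: disjointWl (subset_trans (subsetDl _ _) (subsetDl _ _)) _.
  by rewrite disjoint_sym; apply: disjointWl (subsetDl _ _) _.
have AW := subset_leq_card (subsetDl A W).
have sAW : A :\: W = A by apply/eqP; rewrite eqEcard subsetDl /=; lia.
have /eqP BW0 : #|B :\: W| == 0 by lia.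
rewrite inE CW /= (card_setD_split W sAZ); apply/and3P; split.
- by rewrite sAW; lia.
- by rewrite subsetD sAZ; apply/setDidPl.
- rewrite subsetD dBZ andbT -setD_eq0 -cards_eq0; exact/eqP.
Qed.

Lemma blocks_unique Z A B W W' : Z \in C -> 2 * e + 1 < #|A| + #|B| ->
  W \in blocks Z A B -> W' \in blocks Z A B -> W = W'.
Proof.
move=> CZ cAB BW BW'; apply/eqP; apply: contraLR cAB => neqW.
rewrite -leqNgt; apply: leq_trans (blocks_meet CZ BW BW' neqW).
move: BW BW'; rewrite !inE => /and4P[_ _ sA sB] /and4P[_ _ sA' sB'].
by apply: leq_add; rewrite subset_leq_card // subsetI ?sA ?sB.
Qed.

Lemma blocks_sub Z A B A' B' : A' \subset A -> B' \subset B ->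
  blocks Z A B \subset blocks Z A' B'.
Proof.
move=> sA sB; apply/subsetP => W; rewrite !inE => /and4P[-> -> sAW sBW].
by rewrite (subset_trans sA) ?(subset_trans sB).
Qed.

(** Counting pairs (D, W) with A \subset D \subset Z :\: W and #|D| = e + 1 in two
    ways: D determines W, and W allows C(e + j, j) choices of D. *)
Lemma card_blocks Z A B j : Z \in C -> A \subset Z -> [disjoint B & Z] ->
  #|A| + j = e.+1 -> #|B| = e.+1 ->
  #|blocks Z A B| * 'C(e + j, j) = 'C(w - #|A|, j).
Proof.
move=> CZ sAZ dBZ cA cB.
have := double_count (fun W => W \in blocks Z A B)
  (fun D : {set V} => (A \subset D) && (D \subset Z) && (#|D| == e.+1))
  (fun W D => D \subset Z :\: W).
rewrite (eq_bigr (fun=> 'C(e + j, j))) => [|W BW]; last first.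
  move: (BW); rewrite !inE => /and4P[CW /eqP cZW sAW _].
  rewrite (eq_card (B := [set D : {set V} | (A \subset D) && (D \subset Z :\: W) & #|D| == e.+1])); last first.
    move=> D; rewrite !inE subsetD; case: (A \subset D) => //=.
    by case: (D \subset Z) => //=; rewrite andbC.
  rewrite card_between //; last by lia.
  by congr 'C(_, _); lia.
rewrite sum_nat_const => ->.
rewrite (eq_bigr (fun=> 1)) => [|D /andP[/andP[sAD sDZ] /eqP cD]]; last first.
  have [W BW] := blocks_exist CZ sDZ dBZ cD cB.
  apply/eqP/cards1P; exists W; apply/setP => W'; rewrite !inE.
  apply/andP/eqP => [[BW' sDW']|->].
    apply: (@blocks_unique Z D B) => //; first by rewrite cD cB; lia.
    by move: BW'; rewrite !inE sDW' => /and4P[-> -> _ ->].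
  by move: BW; rewrite !inE => /and4P[-> -> sDW ->]; rewrite (subset_trans sAD).
rewrite sum1_card -(Cw CZ) -(_ : e.+1 - #|A| = j); last by lia.
rewrite -card_between //; last by lia.
by apply: eq_card => D; rewrite !inE.
Qed.

Lemma tiling_inhabited : w <= #|V| -> exists Z, Z \in C.
Proof.
rewrite -cardsT => /exists_subset_card[X _ cX].
by have [Z [CZ _ _]] := tiling.2 X cX; exists Z.
Qed.

(** Roos' bound. Fix A of size e and B of size e + 1. The m blocks through
    (A, B) partition Z :\: A into sets of size e + 1, and on the other side,
    outside B, they are pairwise disjoint sets of size e. *)
Lemma tiling_roos : e < w -> e < #|V| - w ->
  exists m, m * e.+1 = w - e /\ m * e <= #|V| - w - e.+1.
Proof.
move=> ew eb; have [|Z CZ] := tiling_inhabited; first by lia.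
have cZ := Cw CZ; have cZC : #|~: Z| = #|V| - w by rewrite cardsCs setCK cZ.
have [|A sAZ cA] := @exists_subset_card _ Z e; first by rewrite cZ ltnW.
have [|B sBZ cB] := @exists_subset_card _ (~: Z) e.+1; first by rewrite cZC.
have dBZ : [disjoint B & Z] by rewrite disjoints_subset.
exists #|blocks Z A B|; split.
  by have := card_blocks CZ sAZ dBZ (_ : #|A| + 1 = _) cB; rewrite cA !bin1 addn1; apply.
have := double_count (fun W => W \in blocks Z A B)
  (fun v => v \in ~: Z :\: B) (fun W v => v \in W).
rewrite (eq_bigr (fun=> e)) => [|W]; last first.
  rewrite inE => /and4P[CW /eqP cZW _ sBW].
  have -> : [set v | v \in ~: Z :\: B & v \in W] = (W :\: Z) :\: B.
    by apply/setP=> v; rewrite !inE -andbA; congr (_ && _); rewrite andbC.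
  have cWZ : #|W :\: Z| = 2 * e + 1 by rewrite card_setD_sym // !Cw.
  by rewrite cardsDS // cWZ cB; lia.
rewrite sum_nat_const => ->; rewrite -cB -cZC -cardsDS // -sum1_card.
apply: leq_sum => v; rewrite !inE => /andP[vB vZ].
have arith : 2 * e + 1 < e + e.+2 by clear; lia.
rewrite leqNgt; apply/negP => /card_gt1P[W [W' []]]; rewrite !inE.
move=> /andP[/and4P[CW cW sAW sBW] vW] /andP[/and4P[CW' cW' sAW' sBW'] vW'].
case/eqP; apply: (@blocks_unique Z A (v |: B)) => //.
- by rewrite cardsU1 vB cA cB.
- by rewrite !inE CW cW sAW subUset sBW sub1set !inE vW vZ.
- by rewrite !inE CW' cW' sAW' subUset sBW' sub1set !inE vW' vZ.
Qed.

(** Fix a block W through (A, B) and a point u outside Z and W. The blocks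
    through (A0, u |: B0) partition Z :\: A0 into sets of size e + 1, each of
    which meets the e + 1 points of (Z :\: W) :\: A0 at most once: there are at
    least e + 1 of them. *)
Lemma tiling_large : e < w -> 2 * e + 1 < #|V| - w -> e.+1 ^ 2 <= w - e.
Proof.
move=> ew eb; have [|Z CZ] := tiling_inhabited; first by lia.
have cZ := Cw CZ; have cZC : #|~: Z| = #|V| - w by rewrite cardsCs setCK cZ.
have disj (B : {set V}) : B \subset ~: Z -> [disjoint B & Z].
  by rewrite disjoints_subset.
have [|A sAZ cA] := @exists_subset_card _ Z e.+1; first by rewrite cZ.
have [|B sBZ cB] := @exists_subset_card _ (~: Z) e.+1; first by rewrite cZC; lia.
have [W BW] := blocks_exist CZ sAZ (disj _ sBZ) cA cB.
have [A0 sA0 cA0] : exists2 A0 : {set V}, A0 \subset A & #|A0| = e.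
  by apply: exists_subset_card; rewrite cA.
have [B0 sB0 cB0] : exists2 B0 : {set V}, B0 \subset B & #|B0| = e.
  by apply: exists_subset_card; rewrite cB.
have := BW; rewrite inE => /and4P[CW /eqP cZW sAW sBW].
have cWZ : #|W :\: Z| = 2 * e + 1 by rewrite card_setD_sym // !Cw.
have [u] : exists u, u \in ~: Z :\: (W :\: Z).
  apply/set0Pn; rewrite -card_gt0 cardsDS ?cZC ?cWZ; first by lia.
  by rewrite setDE subsetIr.
rewrite !inE => /andP[]; rewrite negb_and negbK => /orP[uZ|uW]; first by rewrite uZ.
move=> uZ; have sA0Z := subset_trans sA0 sAZ.
have uB0 : u \notin B0.
  apply: contra uW => uB; have := subsetP sBW u (subsetP sB0 u uB).
  by rewrite !inE => /andP[].
have dB0 : [disjoint u |: B0 & Z].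
  by rewrite disj // subUset sub1set inE uZ (subset_trans sB0).
have cuB0 : #|u |: B0| = e.+1 by rewrite cardsU1 uB0 cB0.
have Em : #|blocks Z A0 (u |: B0)| * e.+1 = w - e.
  have := card_blocks CZ sA0Z dB0 (_ : #|A0| + 1 = _) cuB0.
  by rewrite cA0 !bin1 addn1; apply.
rewrite -Em -mulnn leq_mul2r /=.
have cD : #|(Z :\: W) :\: A0| = e.+1.
  have -> : e.+1 = 2 * e + 1 - e by clear; lia.
  by rewrite cardsDS ?cA0 ?cZW ?(subset_trans sA0).
have blk y : y \in (Z :\: W) :\: A0 -> exists W', W' \in blocks Z (y |: A0) (u |: B0).
  rewrite !inE => /and3P[yA yW yZ]; apply: blocks_exist => //.
    by rewrite subUset sub1set yZ.
  by rewrite cardsU1 yA cA0.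
have [f fP] : exists f : V -> {set V}, forall y, y \in (Z :\: W) :\: A0 ->
    f y \in blocks Z (y |: A0) (u |: B0).
  have /fin_all_exists[f fP] : forall y, exists W', y \in (Z :\: W) :\: A0 ->
     W' \in blocks Z (y |: A0) (u |: B0).
    move=> y; case: (boolP (y \in _)) => [/blk[W' BW']|_]; last by exists set0.
    by exists W'.
  by exists f.
rewrite -cD -(card_in_imset (f := f)) => [|x y Dx Dy fxy].
  apply: subset_leq_card; apply/subsetP=> _ /imsetP[y Dy ->].
  by apply: subsetP (fP _ Dy); apply: blocks_sub; rewrite ?subsetUr.
apply/eqP; apply/negPn/negP => neq_xy.
have Bx := fP _ Dx; have By := fP _ Dy.
have neqW : W != f x.
  apply: contraNneq uW => ->; move: Bx; rewrite inE => /and4P[_ _ _ /subsetP sB].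
  by have := sB u; rewrite !inE eqxx => /(_ isT)/andP[].
have := blocks_meet CZ BW Bx neqW; apply/negP; rewrite -ltnNge.
have arith m n : e.+2 <= m -> e <= n -> 2 * e + 1 < m + n by clear; lia.
rewrite -fxy in By; move: Bx By Dx Dy; rewrite !inE.
move=> /and4P[_ _ sAx sBx] /and4P[_ _ sAy _] /and3P[xA xW xZ] /and3P[yA yW yZ].
have : [set x; y] :|: A0 \subset (Z :\: W) :&: (Z :\: f x).
  rewrite subsetI !subUset !sub1set !inE xW yW xZ yZ (subset_trans sA0) //=.
  move: sAx sAy; rewrite !subUset !sub1set !inE => /andP[/andP[-> _] ->].
  by move=> /andP[/andP[-> _] _].
move/subset_leq_card; rewrite -setUA !cardsU1 !inE negb_or neq_xy xA yA cA0.
move=> cAA; apply: arith => //; rewrite -cB0; apply: subset_leq_card.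
rewrite subsetI (subset_trans sB0) //=.
by apply: subset_trans sBx; apply: subsetUr.
Qed.

(** A Steiner system S(2, e+2, w+2). If S has w + 2 points and no codeword W has
    fewer than e points outside S, then removing a pair J from S leaves a set
    covered by the only W with #|W :\: S| = e and J \subset S :\: W. Such an S is
    obtained from Z by exchanging e points for e + 2; it fails only if a block
    through (A, B) contains the last added point u, and w <= #|V| - w leaves room
    for another u. *)
Lemma tiling_pairs : 2 * e + 1 < w -> w <= #|V| - w -> 'C(e.+2, 2) %| 'C(w.+2, 2).
Proof.
move=> ew wb; have [|Z CZ] := tiling_inhabited; first by lia.
have cZ := Cw CZ; have cZC : #|~: Z| = #|V| - w by rewrite cardsCs setCK cZ.
have [|A sAZ cA] := @exists_subset_card _ Z e; first by rewrite cZ; lia.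
have [|B sBZ cB] := @exists_subset_card _ (~: Z) e.+1; first by rewrite cZC; lia.
have dBZ : [disjoint B & Z] by rewrite disjoints_subset.
have Em : #|blocks Z A B| * e.+1 = w - e.
  by have := card_blocks CZ sAZ dBZ (_ : #|A| + 1 = _) cB; rewrite cA !bin1 addn1; apply.
(* The blocks through (A, B) cover only m e < #|~: Z :\: B| points outside B. *)
have [u uZ uBlocks] : exists2 u, u \in ~: Z :\: B
    & forall W, W \in blocks Z A B -> u \notin W.
  have U_lt : #|\bigcup_(W in blocks Z A B) ((W :\: Z) :\: B)| < #|~: Z :\: B|.
    rewrite cardsDS // cZC cB.
    apply: (@leq_ltn_trans (\sum_(W in blocks Z A B) #|(W :\: Z) :\: B|)).
      elim/big_rec2: _ => [|W n U _ IH]; first by rewrite cards0.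
      by rewrite (leq_trans (leq_card_setU _ _)) // leq_add2l.
    rewrite (eq_bigr (fun=> e)) => [|W]; last first.
      rewrite inE => /and4P[CW /eqP cZW _ sBW].
      have cWZ : #|W :\: Z| = 2 * e + 1 by rewrite card_setD_sym // !Cw.
      by rewrite cardsDS // cWZ cB; lia.
    rewrite sum_nat_const; case: #|_| Em => [|[|m]]; nia.
  have /subsetPn[u uZB uU] : ~~ (~: Z :\: B \subset
      \bigcup_(W in blocks Z A B) ((W :\: Z) :\: B)).
    by apply: contraL U_lt => /subset_leq_card; rewrite -leqNgt.
  exists u => // W BW; apply: contra uU => uW; apply/bigcupP; exists W => //.
  by move: uZB; rewrite !inE uW andbT.
move: uZ; rewrite !inE => /andP[uB uZ].
pose S := (Z :\: A) :|: (u |: B).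
have duBZ : [disjoint u |: B & Z].
  by rewrite disjoints_subset subUset sub1set inE uZ.
have cuB : #|u |: B| = e.+2 by rewrite cardsU1 uB cB.
have cS : #|S| = w.+2.
  rewrite cardsU disjoint_setI0; last first.
    by apply: disjointWl (subsetDl _ _) _; rewrite disjoint_sym.
  by rewrite cards0 subn0 cardsDS // cZ cA cuB; lia.
have far W : W \in C -> e <= #|W :\: S|.
  move=> CW.
  have sA : A :&: S = set0.
    apply/setP=> x; rewrite !inE; case: (boolP (x \in A)) => //= xA.
    have xZ := subsetP sAZ x xA.
    apply/negP=> /orP[/eqP xu|xB]; first by rewrite xu (negPf uZ) in xZ.
    by have := disjointFr dBZ xB; rewrite xZ.
  have [->|neqWZ] := eqVneq W Z.
    by rewrite -cA subset_leq_card // subsetD sAZ -setI_eq0 sA eqxx.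
  have d_gt : 2 * e < #|W :\: Z|.
    rewrite ltnNge; apply: contra neqWZ => d_le.
    by apply/eqP; apply: tiling_min_distance.
  have split_WS : #|W :&: A| + #|(W :\: Z) :\: (u |: B)| = #|W :\: S|.
    rewrite -(cardsID Z (W :\: S)) /S; move: (u |: B) duBZ => U dUZ.
    have U_imp x : (x \in U) ==> (x \notin Z).
      by apply/implyP => xU; rewrite (disjointFr dUZ xU).
    have A_imp x : (x \in A) ==> (x \in Z) by apply/implyP/(subsetP sAZ).
    congr (_ + _); apply: eq_card => x; move: (U_imp x) (A_imp x); rewrite !inE;
      by do 4?case: (x \in _).
  have B_le : #|(W :\: Z) :&: (u |: B)| <= e.+2 by rewrite -cuB subset_leq_card ?subsetIr.
  rewrite leqNgt; apply/negP => d_lt.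
  have := cardsID (u |: B) (W :\: Z) => split_WZ.
  have WA0 : #|W :&: A| = 0 by clear - d_gt split_WS B_le d_lt split_WZ; lia.
  have WB : #|(W :\: Z) :&: (u |: B)| = e.+2 by clear - d_gt split_WS B_le d_lt split_WZ; lia.
  have dZW : #|W :\: Z| = 2 * e + 1 by clear - d_gt split_WS B_le d_lt split_WZ; lia.
  have sBW : u |: B \subset W :\: Z.
    by apply/setIidPr/eqP; rewrite eqEcard subsetIr WB cuB /=.
  move: sBW; rewrite subUset sub1set => /andP[uW sBW].
  have BW : W \in blocks Z A B.
    have cZW : #|Z :\: W| = 2 * e + 1 by rewrite -dZW card_setD_sym // !Cw.
    rewrite inE CW cZW eqxx sBW andbT /=.
    by rewrite subsetD sAZ -setI_eq0 -cards_eq0 setIC WA0.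
  by move: uW; rewrite inE (negPf (uBlocks W BW)) andbF.
have far_sym W : W \in C -> #|S :\: W| = #|W :\: S|.+2.
  by move=> /Cw cW; have := cardsID S W; have := cardsID W S; rewrite setIC; lia.
have := double_count (fun W => W \in [set W in C | #|W :\: S| == e])
  (fun J : {set V} => (J \subset S) && (#|J| == 2))
  (fun W J => J \subset S :\: W).
rewrite (eq_bigr (fun=> 'C(e.+2, 2))) => [|W]; last first.
  rewrite inE => /andP[CW /eqP dW]; rewrite -dW -far_sym //.
  rewrite -[RHS](cards_draws (S :\: W) 2); apply: eq_card => J.
  by rewrite !inE subsetD; case: (J \subset S) => //=; rewrite andbC.
rewrite sum_nat_const => E; rewrite -cS -cards_draws.
apply/dvdnP; eexists; symmetry; apply: etrans E _; rewrite -sum1_card.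
rewrite [RHS](eq_bigl (fun J : {set V} => (J \subset S) && (#|J| == 2))) => [|J];
  last by rewrite inE.
apply: eq_bigr => J; move=> /andP[sJS /eqP cJ].
have cSJ : #|S :\: J| = w by rewrite cardsDS // cS cJ subn2.
have [W [CW dW uniqW]] := tiling.2 _ cSJ.
have dist W' : W' \in C -> #|(S :\: J) :\: W'| + #|J :\: W'| = #|W' :\: S| + 2.
  by move=> CW'; rewrite -card_setD_split // far_sym // addn2.
have JW W' : #|J :\: W'| <= 2 by rewrite -cJ subset_leq_card ?subsetDl.
apply/eqP/cards1P; exists W; apply/setP=> W'; rewrite !inE subsetD sJS /=.
apply/andP/eqP => [[/andP[CW' /eqP dW'] /setDidPl JW']|->].
  apply: uniqW => //; have := dist _ CW'; rewrite JW' cJ dW'.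
  by clear; lia.
have := dist _ CW; have := far _ CW; have := JW W => JW2 dS dSJ.
have dWS : #|W :\: S| = e by clear - dW JW2 dS dSJ; lia.
split; first by rewrite CW dWS eqxx.
apply/setDidPl/eqP; rewrite eqEcard subsetDl cJ /=.
by clear - dW dWS dSJ; lia.
Qed.

End Local.
(** Small parameters only leave trivial codes: two distinct codewords force
    both w and #|V| - w to be at least 2e + 1, and Roos' bound on both sides
    forces equality for both as soon as one of them is at most 2e + 1. *)
Lemma tiling_trivial w e C : 0 < e -> w <= #|V| -> ball_tiling w e C ->
  w <= 2 * e + 1 \/ #|V| - w <= 2 * e + 1 ->
  #|C| = 1 \/ [/\ #|V| = 2 * w, w = 2 * e + 1
    & exists2 W, W \in C & C = [set W; ~: W]].
Proof.
move=> e0 wV tiling small; have [Z CZ] := tiling_inhabited tiling wV.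
have Cw W : W \in C -> #|W| = w by case: tiling => + _; apply.
have far W : W \in C -> W != Z -> 2 * e < #|Z :\: W|.
  by move=> CW; rewrite ltnNge eq_sym; apply: contra => /(tiling_min_distance tiling CZ CW)->.
have [/set0Pn[W]|] := boolP (C :\ Z != set0); last first.
  rewrite negbK => /eqP C1; left; rewrite (cardsD1 Z) CZ C1 cards0; exact: addn0.
rewrite !inE => /andP[neqWZ CW]; right.
have dist_w W' : #|Z :\: W'| <= w by rewrite -(Cw _ CZ) subset_leq_card ?subsetDl.
have dist_b W' : W' \in C -> #|Z :\: W'| <= #|V| - w.
  move=> /Cw cW'; have -> : #|V| - w = #|~: W'| by rewrite [RHS]cardsCs setCK cW'.
  by rewrite subset_leq_card // setDE subsetIr.
have w_gt : 2 * e < w by apply: leq_trans (dist_w W); apply: far.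
have b_gt : 2 * e < #|V| - w by apply: leq_trans (dist_b W CW); apply: far.
have [Ew EV] : w = 2 * e + 1 /\ #|V| - w = 2 * e + 1.
  have [||m [Em m_le]] := tiling_roos tiling; [lia | lia |].
  have := tiling_roos (ball_tiling_setC wV tiling).
  case=> [||m' [Em' m'_le]]; [lia | lia |].
  rewrite subKn // in m'_le.
  clear - e0 small w_gt b_gt Em m_le Em' m'_le; nia.
have {EV} EV : #|V| = 2 * w by lia.
have compl W' : W' \in C -> W' != Z -> W' = ~: Z.
  move=> CW' neqW'; have := far _ CW' neqW'; have := dist_w W' => dw df.
  have cD : #|Z :\: W'| = w by lia.
  have sD : Z :\: W' = Z by apply/eqP; rewrite eqEcard subsetDl cD (Cw _ CZ) leqnn.
  apply/eqP; rewrite eqEcard -disjoints_subset disjoint_sym; apply/andP; split.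
    exact/setDidPl.
  by rewrite cardsCs setCK (Cw _ CZ) (Cw _ CW') EV; lia.
split=> //; exists Z => //; apply/setP=> W'; rewrite !inE.
apply/idP/idP => [CW'|/orP[/eqP->//|/eqP->]]; last by rewrite -(compl W).
by have [//|/(compl _ CW')->] := eqVneq W' Z; rewrite eqxx.
Qed.

End Tilings.

(** * Perfect codes as designs *)

Section Design.
Variable V : finType.
Implicit Types (w e : nat) (C : {set {set V}}) (A B P Q S T W X Y : {set V}).

(** A set X at distance d from Y is determined by its traces on Y and on the
    complement of Y, which vary independently between the traces of T and the
    whole. *)
Lemma card_sphere w Y T d : #|Y| = w -> #|T| <= w ->
  #|[set X : {set V} | [&& #|X| == w, T \subset X & #|X :\: Y| == d]]|
   = (#|T :\: Y| <= d) * 'C(w - #|T| + #|T :\: Y|, d)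
       * 'C(#|V| - w - #|T :\: Y|, d - #|T :\: Y|).
Proof.
move=> cY Tw; set s := #|T :\: Y|; set r := #|T :&: Y|.
have cT : r + s = #|T| by apply: cardsID.
have r_le : r <= w by rewrite -cY subset_leq_card ?subsetIr.
have [/andP[sd dw]|small] := boolP ((s <= d) && (d + r <= w)); last first.
  rewrite (_ : [set X | _] = set0) ?cards0; last first.
    apply/setP=> X; rewrite !inE; apply: contraNF small.
    move=> /and3P[/eqP cX sTX /eqP dX].
    have -> : s <= d by rewrite /s -dX subset_leq_card ?setSD.
    have := cardsID Y X; rewrite cX dX => <-.
    by rewrite addnC leq_add2r subset_leq_card ?setSI.
  have [sd|//] := leqP s d.
  rewrite sd /= -ltnNge in small.
  by rewrite [X in _ * X * _]bin_small ?muln0 //; lia.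
pose A := [set P : {set V} | (T :&: Y \subset P) && (P \subset Y) & #|P| == w - d].
pose B := [set Q : {set V} | (T :\: Y \subset Q) && (Q \subset ~: Y) & #|Q| == d].
have cA : #|A| = 'C(w - #|T| + s, d).
  rewrite card_between ?subsetIr //; last by rewrite -/r; lia.
  rewrite cY -/r -bin_sub; last by lia.
  by congr 'C(_, _); lia.
have cB : #|B| = 'C(#|V| - w - s, d - s).
  by rewrite card_between // ?setDE ?subsetIr // -setDE -/s [#|~: Y|]cardsCs setCK cY.
rewrite sd mul1n -cA -cB -cardsX.
have inAB P Q : (P, Q) \in setX A B ->
  [/\ (P :|: Q) :&: Y = P & (P :|: Q) :\: Y = Q].
  rewrite !inE /= => /andP[/andP[/andP[_ sPY] _] /andP[/andP[_ sQY] _]].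
  split; apply/setP=> x; move: (introT implyP (subsetP sPY x)) (introT implyP (subsetP sQY x));
    by rewrite !inE; do 3?case: (x \in _).
rewrite -(card_in_imset (f := fun PQ => PQ.1 :|: PQ.2)); last first.
  move=> [P Q] [P' Q'] /inAB[EP EQ] /inAB[EP' EQ'] /= eqPQ.
  by congr (_, _); [rewrite -EP eqPQ | rewrite -EQ eqPQ].
apply: eq_card => X; rewrite inE; apply/and3P/imsetP.
  move=> [/eqP cX sTX /eqP dX]; exists (X :&: Y, X :\: Y); last by rewrite /= setID.
  have cI := cardsID Y X; rewrite cX dX in cI.
  rewrite !inE /= setSI // subsetIr setSD // dX eqxx setDE subsetIr /= !andbT.
  by apply/eqP; lia.
case=> [[P Q] PQ_AB ->] /=; have [EP EQ] := inAB _ _ PQ_AB; rewrite EQ.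
move: PQ_AB; rewrite !inE /= => /andP[/andP[/andP[sTP _] cP] /andP[/andP[sTQ _] cQ]].
split=> //; last by rewrite -(setID T Y) setUSS.
by rewrite -(cardsID Y (P :|: Q)) EP EQ (eqP cP) (eqP cQ) subnK //; lia.
Qed.

Lemma card_near w e Y T : #|Y| = w -> #|T| <= w ->
  #|[set X : {set V} | [&& #|X| == w, T \subset X & #|X :\: Y| <= e]]|
   = \sum_(d < e.+1) (#|T :\: Y| <= d) * 'C(w - #|T| + #|T :\: Y|, d)
       * 'C(#|V| - w - #|T :\: Y|, d - #|T :\: Y|).
Proof.
move=> cY Tw; under eq_bigr => d _ do rewrite -card_sphere // -sum1_card.
rewrite -sum1_card (partition_big (fun X => inord #|X :\: Y| : 'I_e.+1) xpredT) //=.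
apply: eq_bigr => d _; apply: eq_bigl => X; rewrite !inE.
case: (#|X| == w) (T \subset X) => [] [] //=.
apply/andP/eqP => [[le_e /eqP <-]|->]; first by rewrite inordK.
by rewrite -ltnS ltn_ord; split=> //; apply/eqP/val_inj; rewrite inord_val.
Qed.

Local Open Scope ring_scope.

(** For a function whose sums over all supersets of any proper subset of T
    vanish, inclusion-exclusion over the trace on T keeps one term only. *)
Lemma sum_trace_eq (R : pzRingType) (g : {set V} -> R) T S :
  (forall T', T' \proper T -> \sum_(X : {set V} | T' \subset X) g X = 0) ->
  S \subset T ->
  \sum_(X : {set V} | X :&: T == S) g X
    = (-1) ^+ #|T :\: S| * \sum_(X : {set V} | T \subset X) g X.
Proof.
have [n] := ubnP #|T :\: S|; elim: n T S => // n IH T S; rewrite ltnS => cTS g0 sST.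
have [T_S|/set0Pn[x]] := eqVneq (T :\: S) set0.
  have -> : S = T by apply/eqP; rewrite eqEsubset sST -setD_eq0 T_S /=.
  rewrite setDv cards0 expr0 mul1r; apply: eq_bigl => X.
  by apply/eqP/idP => [/setIidPr|/setIidPr].
rewrite inE => /andP[xS xT].
have c1 : #|(T :\ x) :\: S| = #|T :\: S|.-1.
  have -> : (T :\ x) :\: S = (T :\: S) :\ x by rewrite !setDDl setUC.
  by rewrite (cardsD1 x (T :\: S)) inE xS xT.
have c2 : #|T :\: (x |: S)| = #|T :\: S|.-1.
  have -> : T :\: (x |: S) = (T :\: S) :\ x by rewrite setDDl setUC.
  by rewrite (cardsD1 x (T :\: S)) inE xS xT.
have c0 : (0 < #|T :\: S|)%N by rewrite (cardsD1 x) inE xS xT.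
have E1 : \sum_(X : {set V} | X :&: (T :\ x) == S) g X = 0.
  rewrite IH ?g0 ?mulr0 ?properD1 //.
  - by rewrite c1; apply: leq_trans cTS; rewrite prednK.
  - by move=> T' /proper_trans lt; apply/g0/lt/properD1.
  - by rewrite subsetD1 sST.
have E2 : \sum_(X : {set V} | X :&: T == x |: S) g X
    = (-1) ^+ #|T :\: S|.-1 * \sum_(X : {set V} | T \subset X) g X.
  rewrite -c2; apply: IH => //; first by rewrite c2; apply: leq_trans cTS; rewrite prednK.
  by rewrite subUset sub1set xT.
have split_x : \sum_(X : {set V} | X :&: (T :\ x) == S) g X
   = \sum_(X : {set V} | X :&: T == S) g X + \sum_(X : {set V} | X :&: T == x |: S) g X.
  rewrite (bigID (fun X : {set V} => x \in X)) /= addrC.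
  congr (_ + _); apply: eq_bigl => X; rewrite setIDA;
    have -> : (x \in X) = (x \in X :&: T) by rewrite inE xT andbT.
    apply/andP/eqP => [[/eqP <- xX]|->]; first by apply/esym/setDidPl; rewrite disjoint_sym disjoints1.
    by split=> //; apply/eqP/setDidPl; rewrite disjoint_sym disjoints1.
  apply/andP/eqP => [[/eqP <- xX]|->]; first by rewrite setD1K.
  by rewrite setU1K // eqxx setU11.
move: E1; rewrite split_x E2 => /eqP; rewrite addr_eq0 => /eqP->.
by rewrite -[in RHS](prednK c0) exprS mulN1r mulNr.
Qed.

Lemma sum_missing_eq (R : comPzRingType) (g : {set V} -> R) T (F : nat -> R) :
  (forall T', T' \proper T -> \sum_(X : {set V} | T' \subset X) g X = 0) ->
  \sum_(X : {set V}) g X * F #|T :\: X|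
    = (\sum_(X : {set V} | T \subset X) g X)
      * \sum_(s < #|T|.+1) (-1) ^+ s * 'C(#|T|, s)%:R * F s.
Proof.
move=> g0; rewrite (partition_big (fun X => X :&: T) (fun S => S \subset T)) /=; last first.
  by move=> X _; apply: subsetIr.
set G := \sum_(X : {set V} | T \subset X) g X.
rewrite (eq_bigr (fun S : {set V} => G * ((-1) ^+ #|T :\: S| * F #|T :\: S|))); last first.
  move=> S sST; rewrite mulrA [G * _](_ : _ = \sum_(X : {set V} | X :&: T == S) g X); last first.
    by rewrite sum_trace_eq // commr_sign.
  rewrite mulr_suml; apply: eq_bigr => X /eqP <-.
  by rewrite setIC setDIr setDv set0U.
rewrite -mulr_sumr; congr (_ * _).
rewrite (reindex_onto (fun S => T :\: S) (fun S => T :\: S)) /=; last first.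
  by move=> S sST; rewrite setDDr setDv set0U (setIidPr sST).
rewrite (eq_bigl (fun S : {set V} => S \subset T)); last first.
  move=> S; rewrite subsetDl /= setDDr setDv set0U.
  by apply/eqP/idP => [<-|/setIidPr//]; rewrite subsetIl.
rewrite (eq_bigr (fun S : {set V} => (-1) ^+ #|S| * F #|S|)); last first.
  by move=> S sST; rewrite setDDr setDv set0U (setIidPr sST).
rewrite (partition_big (fun S => inord #|S| : 'I_#|T|.+1) xpredT) //=.
apply: eq_bigr => s _.
rewrite (eq_bigl (mem [set S : {set V} | S \subset T & #|S| == s])); last first.
  move=> S; rewrite !inE; apply: andb_id2l => sST.
  apply/eqP/eqP => [<-|->]; last by apply: val_inj; rewrite inord_val.
  by rewrite inordK // ltnS subset_leq_card.
rewrite (eq_bigr (fun=> (-1) ^+ s * F s)) => [|S]; last first.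
  by rewrite !inE => /andP[_ /eqP->].
by rewrite sumr_const cards_draws -[LHS]mulr_natl mulrA [_ * (-1) ^+ s]mulrC.
Qed.

(** Delsarte's argument, made elementary. The function g (Phi times the
    indicator of C, minus 1) sums to zero on every ball. Summing over the balls
    centred at the supersets of T, by induction on #|T|, gives the sum of g over
    the supersets of T times the eigenvalue in degree #|T|; as the eigenvalue
    does not vanish the former does, which says that Phi times the number of
    codewords containing T is C(#|V| - t, w - t). *)
Lemma tiling_design w e C t : (w <= #|V|)%N -> ball_tiling w e C ->
  (forall i, (i <= t)%N -> 0 < \sum_(s < i.+1) (-1) ^+ s * 'C(i, s)%:R *
      \sum_(d < e.+1) ((s <= d)%N * 'C(w - i + s, d)
                          * 'C(#|V| - w - s, d - s))%:R :> int) ->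
  (t <= w)%N ->
  (\sum_(i < e.+1) 'C(w, i) * 'C(#|V| - w, i) %| 'C(#|V| - t, w - t))%N.
Proof.
move=> wV tiling eig tw; set Phi := (\sum_(i < e.+1) _)%N.
pose g X : int := if #|X| == w then (Phi * (X \in C))%:R - 1 else 0.
have Cw W : W \in C -> #|W| = w by case: tiling => + _; apply.
have g_sum (P : pred {set V}) : (forall X, P X -> #|X| = w) ->
    \sum_(X | P X) g X = (Phi * #|[set X in C | P X]|)%:R - #|[set X | P X]|%:R.
  move=> Pw; rewrite (eq_bigr (fun X => (Phi * (X \in C))%:R - 1)); last first.
    by move=> X /Pw cX; rewrite /g cX eqxx.
  rewrite sumrB sumr_const -[in #|P|]cardsE; congr (_ - _).
  rewrite -natr_sum -big_distrr /=; congr ((_ * _)%:R).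
  rewrite -sum1_card big_mkcond /= [RHS]big_mkcond; apply: eq_bigr => X _.
  by rewrite inE; case: (X \in C); case: (P X).
have sphere0 X : #|X| = w -> \sum_(Y : {set V}) g Y * (#|X :\: Y| <= e)%N%:R = 0.
  move=> cX.
  rewrite (bigID (fun Y : {set V} => (#|Y| == w) && (#|X :\: Y| <= e)%N)) /=.
  rewrite [X in _ + X]big1 ?addr0 => [|Y]; last first.
    rewrite negb_and /g => /orP[/negPf->|/negPf->]; first by rewrite mul0r.
    by rewrite mulr0.
  rewrite (eq_bigr g) => [|Y /andP[_ ->]]; last by rewrite mulr1.
  rewrite g_sum => [|Y /andP[/eqP]] //.
  have -> : #|[set Y in C | (#|Y| == w) && (#|X :\: Y| <= e)%N]| = 1%N.
    have [W [CW dW uniqW]] := tiling.2 _ cX.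
    apply/eqP/cards1P; exists W; apply/setP=> W'; rewrite !inE.
    apply/and3P/eqP => [[CW' _ dW']|->]; first exact: uniqW.
    by rewrite CW (Cw _ CW) eqxx.
  rewrite muln1; apply/eqP; rewrite subr_eq0; apply/eqP; congr (_%:R).
  have -> : [set Y : {set V} | (#|Y| == w) && (#|X :\: Y| <= e)%N]
     = [set Y : {set V} | [&& #|Y| == w, set0 \subset Y & (#|Y :\: X| <= e)%N]].
    apply/setP=> Y; rewrite !inE sub0set /=; case: eqP => //= cY.
    by rewrite card_setD_sym // cX.
  rewrite card_near ?cards0 // set0D cards0.
  by apply: eq_bigr => i _; rewrite !subn0 addn0 mul1n.
have design T : (#|T| <= t)%N -> \sum_(X : {set V} | T \subset X) g X = 0.
  have [m] := ubnP #|T|; elim: m T => // m IH T; rewrite ltnS => cTm cTt.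
  have proper0 T' : T' \proper T -> \sum_(X : {set V} | T' \subset X) g X = 0.
    move=> /proper_card lt; apply: IH; first exact: leq_trans lt cTm.
    exact: leq_trans (ltnW lt) cTt.
  pose N s : int := \sum_(d < e.+1) ((s <= d)%N * 'C(w - #|T| + s, d)
                          * 'C(#|V| - w - s, d - s))%:R.
  have := sum_missing_eq N proper0.
  have -> : \sum_(X : {set V}) g X * N #|T :\: X| = 0.
    transitivity (\sum_(Y : {set V}) g Y *
        \sum_(X : {set V} | (#|X| == w) && (T \subset X)) (#|X :\: Y| <= e)%N%:R).
      apply: eq_bigr => Y _; rewrite /g; case: eqP => [cY|]; last by rewrite !mul0r.
      congr (_ * _); rewrite /N -natr_sum -card_near //; last exact: leq_trans tw.
      rewrite -natr_sum -sum1_card big_mkcond [in RHS]big_mkcond /=; congr (_%:R).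
      apply: eq_bigr => X _; rewrite inE.
      by case: (#|X| == w) (T \subset X) (#|X :\: Y| <= e)%N => [] [] [].
    under eq_bigr do rewrite mulr_sumr.
    rewrite exchange_big /= big1 // => X /andP[/eqP cX _].
    exact: sphere0.
  move/esym/eqP; rewrite mulf_eq0 => /orP[/eqP//|/eqP E].
  by have := eig _ cTt; rewrite E ltxx.
have [|T _ cT] := @exists_subset_card _ [set: V] t; first by rewrite cardsT; lia.
have := design T; rewrite cT leqnn => /(_ isT).
rewrite (bigID (fun X : {set V} => #|X| == w)) /= [X in _ + X]big1 ?addr0; last first.
  by move=> X /andP[_ /negPf]; rewrite /g => ->.
rewrite g_sum => [|X /andP[_ /eqP]//] /eqP; rewrite subr_eq0 eqr_nat => /eqP E.
have := @card_between _ T [set: V] w (subsetT _); rewrite cT => /(_ tw).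
rewrite cardsT => <-; apply/dvdnP; exists #|[set X in C | (T \subset X) && (#|X| == w)]|.
rewrite mulnC E; apply: eq_card => X; rewrite !inE.
by rewrite subsetT andbT.
Qed.

End Design.

(** * Residues of the parameters and conclusion *)

Lemma mod_between q N e j : 0 < j -> 2 * j <= q -> q %| e + j -> q - j <= N %% q ->
  q - 2 * j < (N + e.+1) %% q <= e %% q.
Proof.
move=> j0 jq dvd Nj.
have q0 : 0 < q by lia.
have Ee : e %% q = q - j.
  have : (e + j) %% q = 0 by apply/eqP.
  have jlt : j < q by lia.
  rewrite -modnDml; have : e %% q < q by rewrite ltn_pmod.
  move: (e %% q) => r rq; have [lt|ge] := ltnP (r + j) q.
    by rewrite modn_small //; lia.
  have -> : r + j = 1 * q + (r + j - q) by lia.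
  by rewrite modnMDl modn_small; lia.
have Nq : N %% q < q by rewrite ltn_pmod.
rewrite addnS -addSn -modnDm Ee.
have [lt|ge] := ltnP (N %% q).+1 q.
  have -> : N.+1 %% q = (N %% q).+1 by rewrite -addn1 -modnDml addn1 modn_small.
  have -> : (N %% q).+1 + (q - j) = 1 * q + ((N %% q).+1 - j) by lia.
  by rewrite modnMDl modn_small; lia.
have -> : N.+1 %% q = 0.
  rewrite -addn1 -modnDml (_ : N %% q + 1 = q) ?modnn //; lia.
by rewrite add0n modn_small; lia.
Qed.

Section Residues.
Variables (V : finType).

Lemma tiling_dvd_bin w e (C : {set {set V}}) j : ball_tiling w e C ->
  e < w -> e < #|V| - w -> j <= e.+1 ->
  'C(e + j, e) %| 'C(w - e.+1 + j, w - e.+1).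
Proof.
move=> tiling ew eb je; have [|Z CZ] := tiling_inhabited tiling; first by lia.
have cZ : #|Z| = w by apply: tiling.1.
have [|A sAZ cA] := @exists_subset_card _ Z (e.+1 - j); first by rewrite cZ; lia.
have [|B sBZ cB] := @exists_subset_card _ (~: Z) e.+1.
  by rewrite cardsCs setCK cZ.
have dBZ : [disjoint B & Z] by rewrite disjoints_subset.
have := card_blocks tiling CZ sAZ dBZ (_ : #|A| + j = _) cB.
rewrite cA subnK // => /(_ erefl) E.
rewrite -[X in X %| _]bin_sub ?leq_addr // addKn.
rewrite -[X in _ %| X]bin_sub ?leq_addr // addKn.
have -> : w - e.+1 + j = w - (e.+1 - j) by lia.
by rewrite -E dvdn_mull.
Qed.

(** With N = w - e - 1, the divisibilities of [tiling_dvd_bin] bound N below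
    modulo p and p^2, and w = N + (e + 1) with e congruent to -j. *)
Lemma tiling_residues w e (C : {set {set V}}) p k l : ball_tiling w e C ->
  e < w -> e < #|V| - w -> prime p -> 0 < k -> 2 * k <= p ->
  2 * (k + p * l) <= p ^ 2 -> p ^ 2 %| e + (k + p * l) ->
  p - 2 * k < w %% p /\
  p ^ 2 - 2 * (k + p * l) < w %% p ^ 2 <= e %% p ^ 2.
Proof.
move=> tiling ew eb p_pr k0 kp jp dvd_e.
set j := k + p * l in jp dvd_e *; set q := p ^ 2 in jp dvd_e *.
have p0 := prime_gt0 p_pr; have j0 : 0 < j by rewrite addn_gt0 k0.
have q0 : 0 < q by rewrite expn_gt0 p0.
have dvd_ek : p %| e + k.
  have : p %| e + j by apply: dvdn_trans dvd_e; rewrite /q expnS dvdn_mulr.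
  by rewrite /j addnA dvdn_addl ?dvdn_mulr.
have je : j <= e.
  have := dvdn_leq (_ : 0 < e + j) dvd_e; rewrite addn_gt0 j0 orbT => /(_ isT).
  by clear - jp; lia.
have ke : k <= e by apply: leq_trans je; apply: leq_addr.
have kp' : k < p by clear - k0 kp; lia.
have jq : j < q by clear - j0 jp; lia.
have dvd1 := tiling_dvd_bin tiling ew eb (leqW ke).
have dvd2 := tiling_dvd_bin tiling ew eb (leqW je).
have [N1 N2] := digits_of_dvd_bin p_pr k0 kp' jq dvd_e dvd1 dvd2.
have Ew : w = w - e.+1 + e.+1 by rewrite subnK.
have := mod_between k0 kp dvd_ek N1; rewrite -Ew => /andP[-> _].
by have := mod_between j0 jp dvd_e N2; rewrite -Ew.
Qed.

(** Divisibility of C(w+2, 2) by 5 puts w in the classes of -1 and -2. *)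
Lemma tiling_residue_pair5 w e (C : {set {set V}}) : ball_tiling w e C ->
  2 * e + 1 < w -> w <= #|V| - w -> 5 %| e + 2 -> w %% 5 != 2.
Proof.
move=> tiling ew wb dvd_e; apply/eqP => w2.
have five (m : nat) : (5 %| 'C(m.+2, 2)) = (5 %| m.+2 * m.+1).
  by rewrite -[X in _ = (5 %| _ * X)]bin1 (mul_bin_diag m.+2 1) Gauss_dvdr.
have : 5 %| 'C(w.+2, 2).
  apply: dvdn_trans (tiling_pairs tiling ew wb).
  by rewrite five; apply: dvdn_mulr; rewrite -[e.+2]addn2.
rewrite five; clear - w2; lia.
Qed.

End Residues.

Section SizeArithmetic.

(** For a and b of comparable size and i = a / 3 the right-hand side is about
    4/9 a^2 and the left-hand side a e^2 / 3, less than a (a - 3e) / 3; the lower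
    bound on e makes b >= 18/19 a, which leaves enough margin. *)
Lemma ball_condition_of_sizes e a b i : 18 <= e -> e.+1 ^ 2 <= a - e ->
  e * a <= e.+1 * b -> 3 * i <= a ->
  i <= b /\ i * e ^ 2 <= (a - i - e) * (b - i - e).
Proof.
move=> e18 ea eab ia.
have a_ge : e * e + 3 * e + 1 <= a by nia.
have b_ge : 18 * a <= 19 * b.
  rewrite -(leq_pmul2l (_ : 0 < e)); last by lia.
  apply: (@leq_trans (18 * (e.+1 * b))).
    by rewrite mulnCA leq_mul2l eab.
  by rewrite !mulnA leq_mul2r; apply/orP; right; lia.
split; first by lia.
have ae : 18 * e <= a by nia.
have x_ge : 2 * a - 3 * e <= 3 * (a - i - e) by lia.
have y_ge : 35 * a - 57 * e <= 57 * (b - i - e) by lia.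
rewrite -(leq_pmul2l (_ : 0 < 171)) //.
apply: (@leq_trans ((2 * a - 3 * e) * (35 * a - 57 * e))); last first.
  by apply: leq_trans (leq_mul x_ge y_ge) _; rewrite mulnACA.
apply: (@leq_trans (57 * (a * (a - 3 * e)))).
  rewrite (_ : 171 = 57 * 3) // -!mulnA leq_mul2l /= mulnA.
  by apply: leq_mul => //; nia.
have [c Ec] : exists c, a = 18 * e + c by exists (a - 18 * e); lia.
rewrite Ec (_ : 18 * e + c - 3 * e = 15 * e + c); last by lia.
rewrite (_ : 2 * (18 * e + c) - 3 * e = 33 * e + 2 * c); last by lia.
rewrite (_ : 35 * (18 * e + c) - 57 * e = 573 * e + 35 * c); last by lia.
by nia.
Qed.

(** Choose q with p^(q+1) <= n < p^(q+2). As a is more than 2/5 of n and p >= 5,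
    the quotient of a by p^q is at least 2, so the remainder is at most a / 3. *)
Lemma base_power_exists p n a b : 5 <= p -> n = a + b -> p <= n ->
  18 * b <= 19 * a ->
  exists q, n < p ^ q.+2 /\ 3 * (a %% p ^ q) <= a.
Proof.
move=> p5 En pn ba; have p1 : 1 < p by lia.
have [q Eq] : exists q, trunc_log p n = q.+1.
  case E : (trunc_log p n) => [|q]; last by exists q.
  by have := trunc_log_max p1 (_ : p ^ 1 <= n); rewrite expn1 E => /(_ pn).
have n0 : 0 < n by lia.
have /andP[lo hi] := trunc_log_bounds p1 n0; rewrite Eq in lo hi.
exists q; split=> //.
have pq0 : 0 < p ^ q by rewrite expn_gt0; lia.
have mod_lt : a %% p ^ q < p ^ q by rewrite ltn_pmod.
have five : 5 * p ^ q <= n by apply: leq_trans lo; rewrite expnS leq_mul2r p5 orbT.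
have quo : 2 <= a %/ p ^ q by rewrite leq_divRL //; lia.
rewrite [X in _ <= X](divn_eq a (p ^ q)).
have : 2 * p ^ q <= a %/ p ^ q * p ^ q by rewrite leq_mul2r quo orbT.
by lia.
Qed.

End SizeArithmetic.

Lemma perfect_code_tiling n w e (C : {set {set 'I_n}}) :
  perfect_code w e C -> ball_tiling w e C.
Proof.
move=> [/subsetP sCJ inj_ball /and3P[/eqP cov /trivIsetP disj _]].
have Cw W : W \in C -> #|W| = w by move=> /sCJ; rewrite inE => /eqP.
have in_ball (X W : {set 'I_n}) : #|X| = w -> W \in C -> (X \in jball w e W) = (#|X :\: W| <= e).
  move=> cX CW; rewrite !inE cX eqxx /= /jdist card_setD_sym //.
  by rewrite cX Cw.
split=> // X cX.
have : X \in cover [set jball w e W | W in C] by rewrite cov inE cX.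
case/bigcupP => _ /imsetP[W CW ->]; rewrite in_ball // => dW.
exists W; split=> // W' CW' dW'; apply/esym/inj_ball => //; apply/eqP.
apply: contraT => neq_balls.
have := disj _ _ (imset_f _ CW) (imset_f _ CW') neq_balls.
rewrite -setI_eq0 => /eqP/setP/(_ X); rewrite inE.
by rewrite !in_ball // dW dW' inE.
Qed.

(** The contradiction between the two lower carries of a + b, which make p^2
    divide the ball size, and the design property at strength w mod p^q. *)
Lemma no_ball_tiling (V : finType) p e l k w (C : {set {set V}}) :
  prime p -> 5 <= p -> p ^ 2 %| e + (k + p * l) -> 0 < e ->
  4 * l <= p - 1 -> 0 < k -> 4 * k <= p + 2 \/ p = 5 /\ k <= 2 ->
  2 * e + 1 < w -> 2 * e + 1 < #|V| - w -> ~ ball_tiling w e C.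
Proof.
move=> p_pr p5 dvd_e e0 l_le k0 k_le ew eb tiling.
set b := #|V| - w in eb *.
have wV : w <= #|V| by rewrite /b in eb; clear - eb; lia.
have tilingC := ball_tiling_setC wV tiling; rewrite -/b in tilingC.
have EbV : #|V| - b = w by rewrite /b subKn.
have j_le : k + p * l + 18 <= p ^ 2 by clear - p5 l_le k0 k_le; nia.
have p_le_e : p ^ 2 <= e + (k + p * l) by rewrite dvdn_leq // addn_gt0 e0.
have e18 : 18 <= e by clear - j_le p_le_e; lia.
have pe : p <= e by clear - p5 p_le_e l_le k_le; nia.
have kp : 2 * k <= p by clear - p5 k_le; lia.
have jp : 2 * (k + p * l) <= p ^ 2 by clear - p5 l_le k_le; nia.
have ew' : e < w by clear - ew; lia.
have eb' : e < b by clear - eb; lia.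
have [aw1 /andP[aw2 aw3]] := tiling_residues tiling ew' eb' p_pr k0 kp jp dvd_e.
have [|ab1 /andP[ab2 ab3]] := tiling_residues tilingC eb' _ p_pr k0 kp jp dvd_e.
  by rewrite EbV.
have not_both2 : p = 5 -> k = 2 -> ~ (w %% p = 2 /\ b %% p = 2).
  move=> Ep Ek [w2 b2]; rewrite Ep in w2 b2.
  have dvd5 : 5 %| e + 2.
    have : 5 %| e + (k + p * l).
      by apply: dvdn_trans dvd_e; rewrite Ep.
    by rewrite Ek Ep addnA dvdn_addl ?dvdn_mulr.
  have [wb|bw] := leqP w b.
    by have := tiling_residue_pair5 tiling ew wb dvd5; rewrite w2.
  have := tiling_residue_pair5 tilingC eb _ dvd5; rewrite b2 EbV => /(_ (ltnW bw)).
  by [].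
(* For p > 5 this is 4 k <= p + 2; for p = 5, k = 2 both residues are at least 2
   and not both equal to 2. *)
have carry1 : p <= w %% p + b %% p.
  clear - aw1 ab1 not_both2 p5 k_le k0.
  have [k4|[Ep k2]] := k_le; first lia.
  have [Ek|k1] : k = 2 \/ k = 1 by lia.
    by have := not_both2 Ep Ek; lia.
  lia.
(* For p = 5, k = 2, l = 1 the lower bounds only sum to 24; attaining them would
   make both residues 12, hence 2 modulo 5. *)
have carry2 : p ^ 2 <= w %% p ^ 2 + b %% p ^ 2.
  have [k4|[Ep k2]] := k_le.
    clear - aw2 ab2 k4 l_le p5.
    have : 4 * (p * l) <= p * (p - 1) by rewrite mulnCA leq_mul2l l_le orbT.
    by move: (w %% _) (b %% _) aw2 ab2 => x y; nia.
  have := modn_dvdm w (dvdn_mulr p (dvdnn p)); have := modn_dvdm b (dvdn_mulr p (dvdnn p)).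
  clear - aw2 ab2 Ep k2 l_le carry1 k0; subst p; rewrite mulnn.
  by move: (w %% 5 ^ 2) (b %% 5 ^ 2) aw2 ab2 => x y; lia.
have dvd_Phi := ball_size_dvd_sqr_prime p_pr carry1 carry2 aw3 ab3.
have large : e.+1 ^ 2 <= w - e by apply: (tiling_large tiling).
have [m [Em m_le]] := tiling_roos tiling ew' eb'.
have [|m' [Em' m'_le]] := tiling_roos tilingC eb' _; first by rewrite EbV.
rewrite EbV in m'_le; rewrite -/b in m_le.
have ewb : e * w <= e.+1 * b.
  have -> : w = m * e.+1 + e by clear - Em ew'; lia.
  by clear - m_le eb'; nia.
have ebw : e * b <= e.+1 * w.
  have -> : b = m' * e.+1 + e by clear - Em' eb'; lia.
  by clear - m'_le ew'; nia.
have bw : 18 * b <= 19 * w.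
  rewrite -(leq_pmul2l e0) mulnCA; apply: leq_trans (leq_mul (leqnn 18) ebw) _.
  by rewrite !mulnA leq_mul2r; apply/orP; right; clear - e18; lia.
have Vwb : #|V| = w + b by rewrite subnKC.
have [|q [V_lt t_le]] := base_power_exists p5 Vwb _ bw.
  by clear - Vwb ew' pe; lia.
set t := w %% p ^ q in t_le.
have tw : t <= w by clear - t_le; lia.
have dvd_design : \sum_(i < e.+1) 'C(w, i) * 'C(b, i) %| 'C(#|V| - t, w - t).
  apply: (tiling_design wV tiling _ tw) => i it.
  have [|ib i_small] := ball_condition_of_sizes e18 large ewb (_ : 3 * i <= w).
    by clear - it t_le; lia.
  apply: ball_eigenvalue_gt0 => //; exact: leq_trans it tw.
have : p ^ 2 %| 'C(w - t + b, w - t).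
  have <- : #|V| - t = w - t + b by clear - Vwb tw; lia.
  exact: dvdn_trans dvd_Phi dvd_design.
rewrite pfactor_dvdn ?bin_gt0 ?leq_addr // => v2.
have : logn p 'C(w - t + b, w - t) <= 1.
  apply: (@logn_bin_le_high p q) => //.
    by rewrite /t [X in X - _](divn_eq w (p ^ q)) addnK dvdn_mull.
  by rewrite addn2; apply: leq_ltn_trans V_lt; clear - Vwb; lia.
by rewrite leqNgt v2.
Qed.

Theorem theorem4p2 (p e : nat) (p_prime : prime p) (p_ge5 : 5 <= p)
    (e_ge1 : 1 <= e) (l k : nat)
    (e_mod : (e%:Z = (- (p%:Z * l%:Z + k%:Z))%R %[mod (p%:Z ^+ 2)%R])%Z)
    (l_le : l <= (p - 1) %/ 4)
    (k_ge1 : 1 <= k)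
    (k_le : 5 < p -> k <= (p + 2) %/ 4)
    (k_le5 : p = 5 -> k <= 2)
    (n w : nat) (w_bounds : 1 <= w <= n - 1) :
  ~ exists C : {set {set 'I_n}}, perfect_code w e C /\ ~ trivial_code w e C.
Proof.
move=> [C [perfect nontrivial]].
have tiling := perfect_code_tiling perfect.
have wn : w <= #|'I_n| by rewrite card_ord; lia.
have [small|] := boolP ((w <= 2 * e + 1) || (#|'I_n| - w <= 2 * e + 1)).
  apply: nontrivial; have := tiling_trivial e_ge1 wn tiling (orP small).
  case=> [C1|[En Ew [W CW EC]]]; first exact: Or32.
  rewrite card_ord in En; apply: Or33; split=> //; exists W => //.
  by rewrite inE; apply/eqP/(proj1 tiling).
rewrite negb_or -!ltnNge => /andP[ew eb].
apply: (@no_ball_tiling _ p e l k w C) tiling => //.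
- have /eqP := e_mod; rewrite eqz_mod_dvd opprK.
  have -> : (p%:Z ^+ 2 = (p ^ 2)%N%:Z)%R by rewrite -!natz natrX.
  have -> : (e%:Z + (p%:Z * l%:Z + k%:Z) = (e + (k + p * l))%N%:Z)%R.
    by rewrite !PoszD PoszM; ring.
  by [].
- by clear - l_le; lia.
- have [p_gt|p_le] := ltnP 5 p; [left | right].
    by have := k_le p_gt; clear; lia.
  have E5 : p = 5 by lia.
  by split=> //; apply: k_le5.
Qed.
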